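(* Let $D$ be a simple derivation of $\Bbbk[x_1,\dots,x_n]$. Then $\operatorname{Aut}(D)^0$ is an affine algebraic group of dimension at most $n$ which acts freely on $\mathbb A^n$, and there exists a family of automorphisms $(\varphi_i)_{i\in\mathbb N}$, with $\varphi_i\in\operatorname{Aut}(D)$, such that $\varphi_0=\mathrm{Id}$ and $$\operatorname{Aut}(D)=\bigcup_{i\in\mathbb N}\varphi_i\operatorname{Aut}(D)^0 .$$ In particular, the sets $X_m=\bigcup_{i=0}^m\varphi_i\operatorname{Aut}(D)^0$, $m\in\mathbb N$, form a filtration of $\operatorname{Aut}(D)$ by (affine) algebraic varieties.
   Context: $\Bbbk$ is an algebraically closed field of characteristic $0$. A derivation $D$ of $\Bbbk[x_1,\dots,x_n]$ is a $\Bbbk$-linear endomorphism with $D(fg)=D(f)g+fD(g)$; it is simple if the only ideals $I$ with $D(I)\subset I$ are the trivial ones. $\operatorname{Aut}(D)$ is the group of $\Bbbk$-algebra automorphisms $\varphi$ of $\Bbbk[x_1,\dots,x_n]$ with $\varphi D=D\varphi$. $\operatorname{Aut}(\Bbbk[x_1,\dots,x_n])$ is canonically identified with $\operatorname{Aut}(\mathbb A^n)$ and is an ind-group, with filtration $\operatorname{Aut}(\Bbbk[x_1,\dots,x_n])_p=\{\varphi=(f_1,\dots,f_n): \deg f_i\le p\ \forall i\}$, where $f_i=\varphi(x_i)$. $\operatorname{Aut}(D)$ is a closed subgroup, hence an ind-group. A closed subgroup $G$ is called algebraic if it is contained in some $\operatorname{Aut}(\Bbbk[x_1,\dots,x_n])_p$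 (it is then an algebraic group acting regularly on $\mathbb A^n$). $\operatorname{Aut}(D)^0$ denotes the connected component of $\operatorname{Aut}(D)$ containing the identity. *)

(* Defs.v *)
From HB Require Import structures.
From mathcomp Require Import all_boot all_order all_algebra.
From mathcomp Require Import mpoly.
From mathcomp Require Import boolp classical_sets.
From mathcomp Require Import topology_structure connected.

Set Implicit Arguments.
Unset Strict Implicit.
Unset Printing Implicit Defensive.

Import GRing.Theory.
Local Open Scope classical_set_scope.
Local Open Scope ring_scope.

Section Derivations.
Variables (k : closedFieldType) (n : nat).
Implicit Types D : {linear {mpoly k[n]} -> {mpoly k[n]}}.

Definition is_ideal (I : set {mpoly k[n]}) : Prop :=
  [/\ I 0, forall f g, I f -> I g -> I (f + g) & forall f g, I g -> I (f * g)].

Definition is_derivation D : Prop := forall f g, D (f * g) = D f * g + f * D g.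

Definition is_simple D : Prop :=
  forall I : set {mpoly k[n]}, is_ideal I -> D @` I `<=` I ->
    I = [set 0] \/ I = setT.

End Derivations.

Section Dimension.
Variable T : topologicalType.

Definition closed_in (A Z : set T) : Prop :=
  exists2 C : set T, closed C & Z = A `&` C.

Definition irreducible (Z : set T) : Prop :=
  Z !=set0 /\
  forall C1 C2 : set T, closed C1 -> closed C2 ->
    Z `<=` C1 `|` C2 -> Z `<=` C1 \/ Z `<=` C2.

(* The Krull dimension of the subspace A is at most d. *)
Definition dim_le (A : set T) (d : nat) : Prop :=
  forall (m : nat) (Z : nat -> set T),
    (forall i, (i <= m)%N -> closed_in A (Z i) /\ irreducible (Z i)) ->
    (forall i, (i < m)%N -> Z i `<` Z i.+1) ->
    (m <= d)%N.

End Dimension.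

(* The points of affine space; an alias of 'rV, so that it can carry the
   Zariski topology. *)
Definition affine (k : closedFieldType) (N : nat) : Type := 'rV[k]_N.
HB.instance Definition _ k N := Choice.copy (affine k N) 'rV[k]_N.

Definition peval (k : closedFieldType) (N : nat)
  (P : {mpoly k[N]}) (v : affine k N) : k := P.@[fun j => v ord0 j].

Section Zariski.
Variables (k : closedFieldType) (N : nat).

(* Complements of the zero loci of arbitrary sets of polynomials. *)
Definition zariski_open : set (set (affine k N)) :=
  [set U | exists S : set {mpoly k[N]},
             U = [set v | exists2 P, S P & peval P v != 0]].

Let zariski_openT : zariski_open setT.
Proof.
exists [set 1]; apply/seteqP; split=> // v _; exists 1 => //.
by rewrite /peval meval1 oner_neq0.
Qed.

Let zariski_openI : setI_closed zariski_open.
Proof.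
move=> _ _ [S1 ->] [S2 ->].
exists [set P | exists P1 P2, [/\ S1 P1, S2 P2 & P = P1 * P2]].
apply/seteqP; split=> v.
- move=> [[P1 S1P1 P1v] [P2 S2P2 P2v]]; exists (P1 * P2).
    by exists P1, P2.
  by rewrite /peval mevalM mulf_neq0.
- move=> [_ [P1 [P2 [S1P1 S2P2 ->]]]].
  rewrite /peval mevalM mulf_eq0 negb_or => /andP[P1v P2v].
  by split; [exists P1|exists P2].
Qed.

Let zariski_open_bigU (I : Type) (f : I -> set (affine k N)) :
  (forall i, zariski_open (f i)) -> zariski_open (\bigcup_i f i).
Proof.
move=> /choice[S fS]; exists [set P | exists i, S i P].
apply/seteqP; split=> v.
- by move=> [i _]; rewrite fS => -[P SP Pv]; exists P => //; exists i.
- by move=> [P [i SP] Pv]; exists i => //; rewrite fS; exists P.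
Qed.

HB.instance Definition _ := isOpenTopological.Build (affine k N)
  zariski_openT zariski_openI zariski_open_bigU.

End Zariski.

Section Morphisms.
Variable k : closedFieldType.

(* g restricts to a regular function on W, i.e. it is locally on W a quotient
   of polynomials; the values of g outside W are irrelevant. *)
Definition regular_on M (W : set (affine k M)) (g : affine k M -> k) : Prop :=
  forall w, W w -> exists P Q : {mpoly k[M]}, peval Q w != 0 /\
    forall w', W w' -> peval Q w' != 0 -> g w' = peval P w' / peval Q w'.

Definition is_morphism M N (W : set (affine k M)) (V : set (affine k N))
    (f : affine k M -> affine k N) : Prop :=
  f @` W `<=` V /\ forall j, regular_on W (fun w => f w ord0 j).

Definition isomorphic_varieties M N
    (W : set (affine k M)) (V : set (affine k N)) : Prop :=
  exists (f : affine k M -> affine k N) (g : affine k N -> affine k M),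
    [/\ is_morphism W V f, is_morphism V W g,
        forall w, W w -> g (f w) = w & forall v, V v -> f (g v) = v].

Definition is_affine M (W : set (affine k M)) : Prop :=
  exists N (V : set (affine k N)), closed V /\ isomorphic_varieties W V.

Definition pair_pt M N (v : affine k M) (w : affine k N) : affine k (M + N) :=
  row_mx (v : 'rV_M) (w : 'rV_N).

Definition prod_set M N (W : set (affine k M)) (V : set (affine k N)) :
    set (affine k (M + N)) :=
  [set u | exists w v, [/\ W w, V v & u = pair_pt w v]].

End Morphisms.

Record polyAut (k : closedFieldType) (n : nat) := PolyAut {
  aut_fun :> {lrmorphism {mpoly k[n]} -> {mpoly k[n]}};
  aut_inv_fun : {lrmorphism {mpoly k[n]} -> {mpoly k[n]}};
  aut_funK : cancel aut_fun aut_inv_fun;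
  aut_inv_funK : cancel aut_inv_fun aut_fun
}.

Section PolyAutGroup.
Variables (k : closedFieldType) (n : nat).
Local Notation R := {mpoly k[n]}.
Local Notation aut := (polyAut k n).

Lemma lrmorphism_ext (f g : {lrmorphism R -> R}) : f =1 g -> f = g.
Proof.
move=> /funext; case: f g => [f cf] [g cg] /= fg; case: _ / fg cg => cg.
congr (GRing.LRMorphism.Pack _).
case: cf cg => [[a1] [a2] [a3]] [[b1] [b2] [b3]].
by rewrite (Prop_irrelevance a1 b1) (Prop_irrelevance a2 b2)
  (Prop_irrelevance a3 b3).
Qed.

Lemma polyAut_ext (phi psi : aut) : phi =1 psi -> phi = psi.
Proof.
case: phi psi => [f f' fK f'K] [g g' gK g'K] /= fg.
have f'g' : f' =1 g' by move=> x; rewrite -[in LHS](g'K x) -fg fK.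
move: (lrmorphism_ext fg) (lrmorphism_ext f'g') => E E'.
by subst g g'; congr PolyAut; apply: Prop_irrelevance.
Qed.

HB.instance Definition _ := gen_eqMixin aut.
HB.instance Definition _ := gen_choiceMixin aut.

Definition aut_id : aut :=
  @PolyAut k n (idfun : {lrmorphism R -> R}) (idfun : {lrmorphism R -> R})
    (fun=> erefl) (fun=> erefl).

Definition aut_comp (phi psi : aut) : aut :=
  @PolyAut k n ((phi \o psi) : {lrmorphism R -> R})
    ((aut_inv_fun psi \o aut_inv_fun phi) : {lrmorphism R -> R})
    (can_comp (aut_funK phi) (aut_funK psi))
    (can_comp (aut_inv_funK psi) (aut_inv_funK phi)).

Definition aut_inv (phi : aut) : aut :=
  PolyAut (aut_inv_funK phi) (aut_funK phi).

Let aut_compA : associative aut_comp.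
Proof. by move=> *; apply: polyAut_ext. Qed.
Let aut_comp1g : left_id aut_id aut_comp.
Proof. by move=> *; apply: polyAut_ext. Qed.
Let aut_compg1 : right_id aut_id aut_comp.
Proof. by move=> *; apply: polyAut_ext. Qed.
Let aut_compVg : left_inverse aut_id aut_inv aut_comp.
Proof. by move=> phi; apply: polyAut_ext => x /=; rewrite aut_funK. Qed.
Let aut_compgV : right_inverse aut_id aut_inv aut_comp.
Proof. by move=> phi; apply: polyAut_ext => x /=; rewrite aut_inv_funK. Qed.

HB.instance Definition _ :=
  isGroup.Build aut aut_compA aut_comp1g aut_compg1 aut_compVg aut_compgV.

End PolyAutGroup.

Section IndGroup.
Variables (k : closedFieldType) (n : nat).
Local Notation aut := (polyAut k n).

Definition aut_deg_le (p : nat) : set aut :=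
  [set phi | forall i : 'I_n, (msize (phi 'X_i) <= p.+1)%N].

Definition coord_index (p : nat) : finType := ('I_n * 'X_{1..n < p.+1})%type.
Definition ncoord (p : nat) : nat := #|coord_index p|.

(* On aut_deg_le p this is the embedding into the finite-dimensional affine
   space of n-tuples of polynomials of degree at most p, given by the
   coefficients of phi(x_1), ..., phi(x_n). *)
Definition coord (p : nat) (phi : aut) : affine k (ncoord p) :=
  \row_(j < ncoord p)
    (phi 'X_(enum_val j).1)@_(val (enum_val j : coord_index p).2).

(* The ind-topology: a set is open iff its trace on each aut_deg_le p is open
   for the topology induced by the Zariski topology of the coefficients. *)
Definition ind_open : set (set aut) :=
  [set A | forall p, exists2 U : set (affine k (ncoord p)),
     open U & aut_deg_le p `&` A = aut_deg_le p `&` coord p @^-1` U].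

Let ind_openT : ind_open setT.
Proof. by move=> p; exists setT; first exact: openT. Qed.

Let ind_openI : setI_closed ind_open.
Proof.
move=> A B oA oB p; have [U oU AU] := oA p; have [V oV BV] := oB p.
exists (U `&` V); first exact: openI.
by rewrite preimage_setI [LHS]setIIr [RHS]setIIr AU BV.
Qed.

Let ind_open_bigU (I : Type) (f : I -> set aut) :
  (forall i, ind_open (f i)) -> ind_open (\bigcup_i f i).
Proof.
move=> fo p; have /choice[U fU] : forall i, exists U : set (affine k (ncoord p)),
    open U /\ aut_deg_le p `&` f i = aut_deg_le p `&` coord p @^-1` U.
  by move=> i; have [U ? ?] := fo i p; exists U.
exists (\bigcup_i U i); first by apply: bigcup_open => i _; have [] := fU i.
rewrite preimage_bigcup !setI_bigcupr.
by apply: eq_bigcupr => i _; have [] := fU i.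
Qed.

HB.instance Definition _ := isOpenTopological.Build aut
  ind_openT ind_openI ind_open_bigU.

(* Z is an (affine) algebraic subvariety of the ind-variety of all
   automorphisms. *)
Definition affine_subvariety (Z : set aut) : Prop :=
  closed Z /\ exists2 p, Z `<=` aut_deg_le p & is_affine (coord p @` Z).

Definition is_subgroup (G : set aut) : Prop :=
  [/\ G 1%g, forall phi psi, G phi -> G psi -> G (phi * psi)%g
    & forall phi, G phi -> G (phi^-1)%g].

Definition regular_mul (G : set aut) (p : nat) : Prop :=
  exists2 m : affine k (ncoord p + ncoord p) -> affine k (ncoord p),
    is_morphism (prod_set (coord p @` G) (coord p @` G)) (coord p @` G) m &
    forall phi psi, G phi -> G psi ->
      m (pair_pt (coord p phi) (coord p psi)) = coord p (phi * psi)%g.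

Definition regular_inv (G : set aut) (p : nat) : Prop :=
  exists2 i : affine k (ncoord p) -> affine k (ncoord p),
    is_morphism (coord p @` G) (coord p @` G) i &
    forall phi, G phi -> i (coord p phi) = coord p (phi^-1)%g.

Definition affine_algebraic_group (G : set aut) : Prop :=
  [/\ is_subgroup G, closed G &
      exists p, [/\ G `<=` aut_deg_le p, is_affine (coord p @` G),
                    regular_mul G p & regular_inv G p]].

(* phi = (f_1, ..., f_n) as a self-map of affine n-space.  The identification
   reverses composition, so this is a right action of the group of
   automorphisms. *)
Definition aut_act (phi : aut) (x : affine k n) : affine k n :=
  \row_(i < n) peval (phi 'X_i) x.

Definition acts_regularly (G : set aut) : Prop :=
  exists2 p, G `<=` aut_deg_le p &
  exists2 a : affine k (ncoord p + n) -> affine k n,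
    is_morphism (prod_set (coord p @` G) setT) setT a &
    forall phi x, G phi -> a (pair_pt (coord p phi) x) = aut_act phi x.

Definition acts_freely (G : set aut) : Prop :=
  forall phi x, G phi -> aut_act phi x = x -> phi = 1%g.

Definition lcoset (phi : aut) (G : set aut) : set aut :=
  [set (phi * psi)%g | psi in G].

(* X is an admissible filtration of A by affine algebraic varieties: the last
   clause says that it is equivalent to the filtration by degree, so that it
   defines the same ind-variety structure on A. *)
Definition affine_filtration (A : set aut) (X : nat -> set aut) : Prop :=
  [/\ forall m, affine_subvariety (X m),
      forall m, X m `<=` X m.+1,
      A = \bigcup_m X m &
      forall p, exists m, A `&` aut_deg_le p `<=` X m].

Definition Aut (D : {linear {mpoly k[n]} -> {mpoly k[n]}}) : set aut :=
  [set phi | forall f, phi (D f) = D (phi f)].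

Definition Aut0 (D : {linear {mpoly k[n]} -> {mpoly k[n]}}) : set aut :=
  connected_component (Aut D) 1%g.

End IndGroup.

(* Main.v *)
Require Import Defs.
From HB Require Import structures.
From mathcomp Require Import all_boot all_order all_algebra.
From mathcomp Require Import mpoly.
From mathcomp Require Import boolp classical_sets.
From mathcomp Require Import topology_structure connected.
Import Defs.

(** A fixed point of [phi] commuting with the simple derivation [D] puts the
    [D]-stable ideal generated by the [phi f - f] inside a maximal ideal, so
    that [phi = 1].  Fix a point [a].  On automorphisms of bounded degree in
    [Aut D] the orbit map [phi |-> phi(a)] is an embedding: the functionals
    [g |-> (D^j g)(a)] separate polynomials, finitely many of them suffice in
    bounded degree, and [(D^j (phi x_i))(a) = (D^j x_i)(phi(a))], so the
    coefficients of [phi] are polynomials in [phi(a)].  Hence a chain of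
    irreducible closed subsets of bounded degree gives a chain of primes of
    [k[x_1, ..., x_n]], of length at most [n]; a maximal irreducible closed
    subset through 1 is the largest one, is a subgroup, and by noetherianity
    finitely many of its cosets cover the automorphisms of each degree.  It is
    therefore open and closed in [Aut D], i.e. it is the identity component. *)

Set Implicit Arguments.
Unset Strict Implicit.
Unset Printing Implicit Defensive.

Import Order.TTheory GRing.Theory.
Local Open Scope classical_set_scope.
Local Open Scope ring_scope.

(** * Noetherianity and dimension of polynomial rings *)

(** Every tail of [u] attains its minimum: [a N] is an index where the tail from [N] does.
    Restarting just after the previous minimiser yields [s], along which the tail minima cannot
    decrease. *)
Lemma subseq_nondecreasing (u : nat -> nat) :
  exists2 s : nat -> nat, {homo s : i j / (i < j)%N} &
    {homo u \o s : i j / (i <= j)%N}.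
Proof.
have /choice[a aP] N : exists i, (N <= i)%N /\ forall j, (N <= j)%N -> (u i <= u j)%N.
  suff H b i : (N <= i)%N -> (u i <= b)%N -> exists i, (N <= i)%N /\
      forall j, (N <= j)%N -> (u i <= u j)%N by apply: (H (u N) N).
  elim: b i => [|b IH] i Ni ui.
    by exists i; split=> // j _; rewrite (leq_trans ui).
  have [H|/existsNP[j]] := pselect (forall j, (N <= j)%N -> (b < u j)%N).
    by exists i; split=> // j /H; apply: leq_trans.
  by move=> /not_implyP[Nj /negP]; rewrite -leqNgt; apply: IH.
pose s i := iter i (fun p => a p.+1) (a 0%N).
have sS i : (s i < s i.+1)%N by rewrite /s /=; have [] := aP (s i).+1.
have slt : {homo s : i j / (i < j)%N}.
  by apply: homo_ltn => // ? ? ?; apply: ltn_trans.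
exists s => //; apply: homo_leq => [?|? ? ?|i] //=; first exact: leq_trans.
have su j N : s j = a N -> (N <= s j.+1)%N -> (u (s j) <= u (s j.+1))%N.
  by move=> ->; have [_ h] := aP N; apply: h.
case: i => [|i]; first by apply: (su 0%N 0%N).
by apply: (su i.+1 (s i).+1) => //; apply: ltn_trans (sS i) (sS i.+1).
Qed.

Lemma subseq_nondecreasing_finite (m : nat) (u : nat -> nat -> nat) :
  exists2 s : nat -> nat, {homo s : i j / (i < j)%N} &
    forall l, (l < m)%N -> {homo u^~ l \o s : i j / (i <= j)%N}.
Proof.
elim: m => [|m [s sP uP]]; first by exists id.
have [t tP utP] := subseq_nondecreasing (u^~ m \o s).
have tle : {homo t : i j / (i <= j)%N} by apply: ltW_homo.
exists (s \o t) => [i j ij|l]; first exact/sP/tP.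
rewrite ltnS leq_eqVlt => /predU1P[->//|lm] i j ij /=.
by apply: uP => //; apply: tle.
Qed.

(** Dickson's lemma: along a subsequence all exponents are nondecreasing at once, so its first two
    terms are already comparable. *)
Lemma dickson n (u : nat -> 'X_{1..n}) :
  exists i j, (i < j)%N /\ (u i <= u j)%MM.
Proof.
have [s sP uP] := subseq_nondecreasing_finite n (fun i l => nth 0%N (u i) l).
exists (s 0%N), (s 1%N); split; first exact: sP.
by apply/mnm_lepP => l; have /= := uP l (ltn_ord l) 0%N 1%N isT; rewrite -!mnm_nth.
Qed.

Section Ideals.
Variables (k : closedFieldType) (n : nat).
Local Notation R := {mpoly k[n]}.
Implicit Types (I P Q : set R) (f g : R) (s t : seq R).

Lemma idealZ I c f : is_ideal I -> I f -> I (c *: f).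
Proof. by move=> [_ _ IM] If; rewrite -mul_mpolyC; apply: IM. Qed.

Lemma idealN I f : is_ideal I -> I f -> I (- f).
Proof. by move=> [_ _ IM] If; rewrite -mulN1r; apply: IM. Qed.

Lemma idealB I f g : is_ideal I -> I f -> I g -> I (f - g).
Proof. by move=> iI If Ig; case: (iI) => [_ ID _]; apply: ID => //; apply: idealN. Qed.

Lemma mlead_min I : (exists f, I f) ->
  exists2 f, I f & forall g, I g -> ~~ (mlead g < mlead f)%O.
Proof.
move=> [f If]; have [m fm] : exists m, mlead f = m by exists (mlead f).
have wf : Acc <%O m by exact: ltom_wf.
elim: wf f fm If => {}m _ IH f fm If.
have [H|/existsNP[g /not_implyP[Ig /negP]]] :=
  pselect (forall g, I g -> ~~ (mlead g < mlead f)%O); first by exists f.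
by rewrite negbK fm => gf; apply: (IH _ gf g).
Qed.

(** Hilbert's basis theorem by leading monomials. If every step were strict, choose [f i] in
    [I i.+1] outside [I i] with minimal leading monomial. By [dickson] some [mlead (f i)] divides
    [mlead (f j)] with [i < j], and reducing [f j] by [f i] contradicts minimality at [j]. *)
Lemma ideal_chain_stationary (I : nat -> set R) :
  (forall i, is_ideal (I i)) -> (forall i, I i `<=` I i.+1) ->
  exists i, I i = I i.+1.
Proof.
move=> iI IS; apply: contrapT => /forallNP nI.
have Imono i j : (i <= j)%N -> I i `<=` I j.
  by move/subnK <-; elim: (j - i)%N => // d IH; apply: subset_trans IH (IS _).
have /choice[f fP] i : exists f, (I i.+1 `\` I i) f /\
    forall g, (I i.+1 `\` I i) g -> ~~ (mlead g < mlead f)%O.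
  have [f] : exists f, (I i.+1 `\` I i) f.
    apply: contrapT => /forallNP H; apply: (nI i); apply/seteqP; split=> // g Ig.
    by apply: contrapT => nIg; apply: (H g).
  by move=> If; have [|g] := @mlead_min (I i.+1 `\` I i); [exists f|exists g].
have [i [j [ij leij]]] := dickson (fun l => mlead (f l)).
have [[fi nfi] _] := fP i; have [[fj nfj] min_fj] := fP j.
have f0 l : f l != 0.
  by apply/eqP => fl; have [[_]] := fP l; rewrite fl; case: (iI l).
(* The leading term of [f j] is cancelled by a multiple of [f i], which lies in [I j] because
   [i < j]; so [h] stays outside [I j]. *)
pose h := f j - (mleadc (f j) / mleadc (f i)) *: ('X_[mlead (f j) - mlead (f i)] * f i).
have Ih' : I j ((mleadc (f j) / mleadc (f i)) *: ('X_[mlead (f j) - mlead (f i)] * f i)).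
  by apply: idealZ => //; have [_ _] := iI j; apply; apply: (Imono i.+1).
have Ih : (I j.+1 `\` I j) h.
  split; first by apply: idealB => //; apply: IS.
  by move=> Ih; apply: nfj; rewrite -[f j](subrK ((mleadc (f j) / mleadc (f i)) *:
    ('X_[mlead (f j) - mlead (f i)] * f i))); case: (iI j) => _ ID _; apply: ID.
have h0 : h != 0 by apply/eqP => h0; case: Ih => _; rewrite h0; case: (iI j).
have /negP := min_fj _ Ih; apply; rewrite lt_neqAle; apply/andP; split.
  apply: contraNneq h0 => hj; rewrite -mleadc_eq0 hj /h mcoeffB mcoeffZ.
  have -> : ('X_[mlead (f j) - mlead (f i)] * f i)@_(mlead (f j)) = mleadc (f i).
    by rewrite -[X in _@_X](submK leij) mulrC mcoeffMX.
  by rewrite divfK ?subrr// mleadc_eq0.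
apply: le_trans (mleadB_le _ _) _; rewrite leUx lexx/=.
apply: le_trans (mleadZ_le _ _) _; apply: le_trans (mleadM_le _ _) _.
by rewrite mleadXm submK.
Qed.

(** * Chains of prime ideals, by counting dimensions *)

Definition prime_ideal P :=
  [/\ is_ideal P, ~ P 1 & forall f g, P (f * g) -> P f \/ P g].

(** Linear independence over [k] of the classes of [s] in the quotient by [P]. *)
Definition indep_mod P s := forall c : nat -> k,
  P (\sum_(0 <= i < size s) c i *: s`_i) -> forall i, (i < size s)%N -> c i = 0.

(** Modulo [Q] the block multiplied by [g] vanishes, which kills the coefficients on [s]. What
    remains is [g] times a combination of [t], and primality of [P] removes the factor [g]. *)
Lemma indep_mod_cat P Q g s t : is_ideal Q -> prime_ideal P -> P `<=` Q ->
    Q g -> ~ P g -> indep_mod Q s -> indep_mod P t ->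
  indep_mod P (s ++ [seq g * x | x <- t]).
Proof.
move=> iQ [iP _ prP] PQ Qg Pg indQ indP c.
rewrite size_cat size_map (big_cat_nat _ (leq_addr _ _)) //=.
rewrite -{2}[size s]add0n big_addn addKn.
rewrite (@eq_big_nat _ _ _ _ _ _ (fun i => c i *: s`_i)); last first.
  by move=> i /= i_s; rewrite nth_cat i_s.
rewrite [X in _ + X](@eq_big_nat _ _ _ _ _ _ (fun i => g * (c (i + size s)%N *: t`_i))); last first.
  move=> i /= it; rewrite nth_cat ltnNge leq_addl/= addnK (nth_map 0)//.
  by rewrite scalerAr.
rewrite -mulr_sumr; set a := \sum_(0 <= i < size s) _; set b := \sum_(0 <= i < size t) _.
move=> Pab.
have cs : forall i, (i < size s)%N -> c i = 0.
  apply: indQ; rewrite -/a -(addrK (g * b) a); apply: idealB => //; first exact: PQ.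
  by rewrite mulrC; case: iQ => _ _; apply.
have ct : forall i, (i < size t)%N -> c (i + size s)%N = 0.
  apply: (indP (fun i => c (i + size s)%N)); rewrite -/b.
  have a0 : a = 0 by apply: big1_seq => i /=; rewrite mem_index_iota => /cs->; rewrite scale0r.
  by move: Pab; rewrite a0 add0r => /prP[].
move=> i; case: (ltnP i (size s)) => [/cs//|si ist].
by rewrite -(subnK si) ct// ltn_subLR.
Qed.

(** The blocks s, g s, ..., g^(M-1) s, nested in Horner form so that [indep_mod_cat] adds one block
    at a time. *)
Fixpoint geom_seq g s (M : nat) :=
  if M is M'.+1 then s ++ [seq g * x | x <- geom_seq g s M'] else [::].

Lemma size_geom_seq g s M : size (geom_seq g s M) = (M * size s)%N.
Proof. by elim: M => //= M IH; rewrite size_cat size_map IH mulSn. Qed.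

Lemma msize_mul_le f g a b : (msize f <= a)%N -> (msize g <= b)%N ->
  (msize (f * g) <= a + b)%N.
Proof.
move=> fa gb; have [->|f0] := eqVneq f 0; first by rewrite mul0r msize0.
have [->|g0] := eqVneq g 0; first by rewrite mulr0 msize0.
by rewrite msizeM//; apply: leq_trans (leq_pred _) (leq_add fa gb).
Qed.

Lemma msize_geom_seq g s M d e : (msize g <= e)%N ->
    {in s, forall f, (msize f <= d)%N} ->
  {in geom_seq g s M, forall f, (msize f <= d + M * e)%N}.
Proof.
move=> ge sd; elim: M => //= M IH f; rewrite mem_cat => /orP[/sd fd|].
  exact: leq_trans fd (leq_addr _ _).
by move=> /mapP[x /IH xd ->]; rewrite mulSn addnCA; apply: msize_mul_le.
Qed.

Lemma indep_mod_geom P Q g s M : is_ideal Q -> prime_ideal P -> P `<=` Q ->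
  Q g -> ~ P g -> indep_mod Q s -> indep_mod P (geom_seq g s M).
Proof.
move=> iQ pP PQ Qg Pg indQ; elim: M => //= M IH.
exact: indep_mod_cat Qg Pg _ _.
Qed.

Lemma card_bmnm_le d : (#|{: 'X_{1..n < d}}| <= d ^ n)%N.
Proof.
case: d => [|d]; first by rewrite eq_card0// => -[].
rewrite -[X in (_ <= X ^ _)%N]card_ord -[X in (_ <= _ ^ X)%N](card_ord n) -card_ffun.
pose F (m : 'X_{1..n < d.+1}) := [ffun i : 'I_n => inord (val m i) : 'I_d.+1].
apply: (@leq_card _ _ F) => m1 m2 /ffunP E; apply: val_inj; apply/mnmP => i.
have mi (m : 'X_{1..n < d.+1}) : (val m i < d.+1)%N.
  by apply: leq_ltn_trans (bmdeg m); rewrite mdegE (bigD1 i)//= leq_addr.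
by have /(congr1 (@nat_of_ord _)) := E i; rewrite !ffunE !inordK.
Qed.

(** As [0] lies in [P], independence modulo [P] implies plain independence, so [s] is no longer than
    the number of monomials of degree below [d]. *)
Lemma indep_mod_size P s d : is_ideal P -> indep_mod P s ->
  {in s, forall f, (msize f <= d)%N} -> (size s <= d ^ n)%N.
Proof.
move=> [P0 _ _] ind sd; apply: leq_trans (card_bmnm_le d).
pose A := \matrix_(i < size s, j < #|{: 'X_{1..n < d}}|) (s`_i)@_(val (enum_val j)).
suff /eqP <- : row_free A by apply: rank_leq_col.
apply/inj_row_free => v vA0; apply/rowP => i; rewrite mxE.
pose c l := oapp (v ord0) 0 (insub l).
have cE (j : 'I_(size s)) : c j = v ord0 j by rewrite /c valK.
have := ind c; rewrite big_mkord; under eq_bigr do rewrite cE.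
suff -> : \sum_(i < size s) v ord0 i *: s`_i = 0.
  by move=> /(_ P0 i (ltn_ord i)); rewrite cE.
apply/mpolyP => m; rewrite mcoeff0 raddf_sum /=.
have [md|md] := ltnP (mdeg m) d; last first.
  apply: big1 => j _; rewrite mcoeffZ memN_msupp_eq0 ?mulr0// msize_mdeg_ge//.
  by apply: leq_trans md; apply: sd; rewrite mem_nth.
move/rowP: vA0 => /(_ (enum_rank (BMultinom md))); rewrite !mxE => vA.
rewrite -[RHS]vA; apply: eq_bigr => j _; by rewrite mcoeffZ !mxE enum_rankK.
Qed.

(* If [g_i] lies in [P_i] but not in [P_(i+1)], the [M^m] monomials in
   [g_0, ..., g_(m-1)] with exponents below [M] are independent modulo [P_m];
   as their degrees grow linearly in [M], letting [M] grow gives [m <= n]. *)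
Lemma prime_chain_le (m : nat) (P : nat -> set R) :
    (forall i, (i <= m)%N -> prime_ideal (P i)) ->
    (forall i, (i < m)%N -> P i.+1 `<` P i) ->
  (m <= n)%N.
Proof.
move=> pP ltP; rewrite leqNgt; apply/negP => nm.
have /choice[g gP] i : exists g, (i < m)%N -> P i g /\ ~ P i.+1 g.
  have [im|] := boolP (i < m)%N; last by exists 0.
  have [_ /existsNP[g /not_implyP[? ?]]] := ltP i im.
  by exists g.
pose L M := fix L (j : nat) := if j is j'.+1 then geom_seq (g j') (L j') M else [:: 1 : R].
have [e eP] : exists e, forall i, (i < m)%N -> (msize (g i) <= e)%N.
  exists (\max_(i < m) msize (g i)) => i im.
  exact: (leq_bigmax_cond (F := fun j : 'I_m => msize (g j)) (Ordinal im)).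
have sL M j : size (L M j) = (M ^ j)%N.
  by elim: j => //= j IH; rewrite size_geom_seq IH expnS.
have dL M j : (j <= m)%N -> {in L M j, forall f, (msize f <= 1 + j * (M * e))%N}.
  elim: j => [_|j IH jm] f /=; first by rewrite inE => /eqP->; rewrite msize1.
  rewrite mulSn addnCA addnC; apply: msize_geom_seq; first exact: eP.
  exact/IH/ltnW.
have iL M j : (j <= m)%N -> indep_mod (P j) (L M j).
  elim: j => [_|j IH jm] /=.
    have [iP P1 _] := pP 0%N isT.
    move=> c; rewrite big_nat1 /= => Pc [|//] _; apply: contrapT => /eqP c0.
    by apply: P1; rewrite -[1](scalerK c0); apply: idealZ.
  have [iP _ _] := pP j (ltnW jm); have [Pg nPg] := gP j jm.
  apply: (indep_mod_geom iP) Pg nPg _; first exact: pP.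
    by have [] := ltP j jm.
  exact/IH/ltnW.
have key M : (0 < M -> M ^ m <= ((1 + m * e) ^ n) * M ^ n)%N.
  move=> M0; rewrite -expnMn -(sL M m); have [iP _ _] := pP m (leqnn m).
  apply: indep_mod_size iP (iL M m (leqnn m)) _ => f /(dL M m (leqnn m)).
  by move=> /leq_trans; apply; rewrite mulnDl mul1n mulnCA mulnC leq_add.
(* With C = (1 + m e)^n and M = C + 1, the assumption n < m gives M^m >= M^(n+1) > C M^n, against
   [key]. *)
have := key ((1 + m * e) ^ n).+1 isT.
rewrite leqNgt => /negP; apply.
rewrite (@leq_trans (((1 + m * e) ^ n).+1 ^ n.+1)%N)//.
  by rewrite expnS ltn_pmul2r// expn_gt0.
by rewrite leq_exp2l//; case: (_ ^ n)%N (expn_gt0 (1 + m * e) n).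
Qed.

End Ideals.

(** * Polynomial functions and families *)

Section ZariskiClosed.
Variables (k : closedFieldType) (N : nat).
Implicit Types (C V W : set (affine k N)) (P : {mpoly k[N]}).

Definition zero_locus (S : set {mpoly k[N]}) : set (affine k N) :=
  [set v | forall P, S P -> peval P v = 0].

Definition vanishing V : set {mpoly k[N]} :=
  [set P | forall v, V v -> peval P v = 0].

Lemma pevalD P Q v : peval (P + Q) v = peval P v + peval Q v.
Proof. exact: mevalD. Qed.

Lemma pevalM P Q v : peval (P * Q) v = peval P v * peval Q v.
Proof. exact: mevalM. Qed.

Lemma closed_zero_locus S : closed (zero_locus S).
Proof.
rewrite -openC; exists S; apply/seteqP; split=> v /=.
  by move=> /existsNP[P /not_implyP[SP /eqP Pv]]; exists P.
by move=> [P SP /eqP Pv] /(_ _ SP).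
Qed.

Lemma zariski_closedE C : closed C -> C = zero_locus (vanishing C).
Proof.
move=> /closed_openC[S CS]; apply/seteqP; split=> v; first by move=> Cv P; apply.
move=> Sv; apply: contrapT => nCv; have : (~` C) v by [].
rewrite CS => -[P SP /eqP]; apply; apply: Sv => w Cw; apply: contrapT => /eqP Pw.
by have : (~` C) w by rewrite CS; exists P.
Qed.

Lemma is_ideal_vanishing V : is_ideal (vanishing V).
Proof.
split=> [v _|P Q VP VQ v Vv|P Q VQ v Vv]; first by rewrite /peval meval0.
  by rewrite pevalD VP// VQ// addr0.
by rewrite pevalM VQ// mulr0.
Qed.

Lemma vanishingS V W : V `<=` W -> vanishing W `<=` vanishing V.
Proof. by move=> VW P WP v /VW /WP. Qed.

End ZariskiClosed.

Section PolynomialFamilies.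
Variables (k : closedFieldType) (X : Type) (S : set X).

(** The map [e] puts coordinates on an arbitrary set. The same calculus then serves for coefficients
    of automorphisms, for orbit points and for pairs of these. *)
Definition poly_fun N (e : X -> affine k N) (h : X -> k) : Prop :=
  exists P, forall x, S x -> h x = peval P (e x).

(* The image of [k[X_1, ..., X_N] (x) V] in the functions from [S] to [V]. *)
Definition poly_family N (e : X -> affine k N) (V : lmodType k) (F : X -> V) : Prop :=
  exists s : seq ({mpoly k[N]} * V),
    forall x, S x -> F x = \sum_(p <- s) peval p.1 (e x) *: p.2.

Section Fixed.
Variables (N : nat) (e : X -> affine k N).
Implicit Types (g h : X -> k) (V W : lmodType k).

Lemma poly_fun_eq g h : (forall x, S x -> g x = h x) -> poly_fun e h -> poly_fun e g.
Proof. by move=> gh [P hP]; exists P => x Sx; rewrite gh// hP. Qed.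

Lemma poly_fun_cst c : poly_fun e (fun=> c).
Proof. by exists c%:MP => x _; rewrite /peval mevalC. Qed.

Lemma poly_fun_coord j : poly_fun e (fun x => e x ord0 j).
Proof. by exists 'X_j => x _; rewrite /peval mevalXU. Qed.

Lemma poly_fun_peval (P : {mpoly k[N]}) : poly_fun e (fun x => peval P (e x)).
Proof. by exists P. Qed.

Lemma poly_funD g h : poly_fun e g -> poly_fun e h -> poly_fun e (fun x => g x + h x).
Proof. by move=> [P gP] [Q hQ]; exists (P + Q) => x Sx; rewrite pevalD gP// hQ. Qed.

Lemma poly_funM g h : poly_fun e g -> poly_fun e h -> poly_fun e (fun x => g x * h x).
Proof. by move=> [P gP] [Q hQ]; exists (P * Q) => x Sx; rewrite pevalM gP// hQ. Qed.

Lemma poly_fun_sum I (r : seq I) (Q : pred I) (h : I -> X -> k) :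
  (forall i, poly_fun e (h i)) -> poly_fun e (fun x => \sum_(i <- r | Q i) h i x).
Proof.
move=> hP; elim: r => [|i r IH].
  by apply: poly_fun_eq (poly_fun_cst 0) => x _; rewrite big_nil.
have [Qi|Qi] := boolP (Q i).
  by apply: poly_fun_eq (poly_funD (hP i) IH) => x _; rewrite big_cons Qi.
by apply: poly_fun_eq IH => x _; rewrite big_cons (negPf Qi).
Qed.

Lemma poly_fun_prod I (r : seq I) (h : I -> X -> k) :
  (forall i, poly_fun e (h i)) -> poly_fun e (fun x => \prod_(i <- r) h i x).
Proof.
move=> hP; elim: r => [|i r IH].
  by apply: poly_fun_eq (poly_fun_cst 1) => x _; rewrite big_nil.
by apply: poly_fun_eq (poly_funM (hP i) IH) => x _; rewrite big_cons.
Qed.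

Lemma poly_fun_det m (A : X -> 'M[k]_m) :
  (forall i j, poly_fun e (fun x => A x i j)) -> poly_fun e (fun x => \det (A x)).
Proof.
move=> AP; apply: poly_fun_sum => s; apply: poly_funM; first exact: poly_fun_cst.
exact: poly_fun_prod.
Qed.

Lemma poly_family_eq V (F G : X -> V) :
  (forall x, S x -> F x = G x) -> poly_family e G -> poly_family e F.
Proof. by move=> FG [s Gs]; exists s => x Sx; rewrite FG// Gs. Qed.

Lemma poly_family_cst V (u : V) : poly_family e (fun=> u).
Proof. by exists [:: (1, u)] => x _; rewrite big_seq1 /peval meval1 scale1r. Qed.

Lemma poly_familyD V (F G : X -> V) :
  poly_family e F -> poly_family e G -> poly_family e (fun x => F x + G x).
Proof.
move=> [s Fs] [t Gt]; exists (s ++ t) => x Sx.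
by rewrite big_cat/= Fs// Gt.
Qed.

Lemma poly_family_sum V I (r : seq I) (Q : pred I) (F : I -> X -> V) :
  (forall i, poly_family e (F i)) -> poly_family e (fun x => \sum_(i <- r | Q i) F i x).
Proof.
move=> hP; elim: r => [|i r IH].
  by apply: poly_family_eq (poly_family_cst 0) => x _; rewrite big_nil.
have [Qi|Qi] := boolP (Q i).
  by apply: poly_family_eq (poly_familyD (hP i) IH) => x _; rewrite big_cons Qi.
by apply: poly_family_eq IH => x _; rewrite big_cons (negPf Qi).
Qed.

Lemma poly_family_linear V W (L : {linear V -> W}) (F : X -> V) :
  poly_family e F -> poly_family e (fun x => L (F x)).
Proof.
move=> [s Fs]; exists [seq (p.1, L p.2) | p <- s] => x Sx.
by rewrite Fs// big_map linear_sum; apply: eq_bigr => p _; rewrite linearZ.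
Qed.

Lemma poly_fun_functional V (L : {scalar V}) (F : X -> V) :
  poly_family e F -> poly_fun e (fun x => L (F x)).
Proof.
move=> [s Fs]; exists (\sum_(p <- s) L p.2 *: p.1) => x Sx.
rewrite Fs// linear_sum /peval raddf_sum; apply: eq_bigr => p _.
by rewrite linearZ /= mevalZ mulrC.
Qed.

Lemma poly_familyZ V h (F : X -> V) :
  poly_fun e h -> poly_family e F -> poly_family e (fun x => h x *: F x).
Proof.
move=> [P hP] [s Fs]; exists [seq (P * p.1, p.2) | p <- s] => x Sx.
rewrite Fs// hP// big_map scaler_sumr; apply: eq_bigr => p _.
by rewrite pevalM scalerA.
Qed.

Section Mpoly.
Variable n : nat.
Implicit Types F G : X -> {mpoly k[n]}.

Lemma poly_familyM F G :
  poly_family e F -> poly_family e G -> poly_family e (fun x => F x * G x).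
Proof.
move=> [s Fs] [t Gt]; exists [seq (p.1 * q.1, p.2 * q.2) | p <- s, q <- t] => x Sx.
rewrite Fs// Gt// big_allpairs_dep mulr_suml; apply: eq_bigr => p _.
rewrite mulr_sumr; apply: eq_bigr => q _.
by rewrite pevalM -scalerAl -scalerAr scalerA.
Qed.

Lemma poly_familyX F m : poly_family e F -> poly_family e (fun x => F x ^+ m).
Proof.
move=> Fp; elim: m => [|m IH].
  by apply: poly_family_eq (poly_family_cst 1) => x _; rewrite expr0.
by apply: poly_family_eq (poly_familyM Fp IH) => x _; rewrite exprS.
Qed.

Lemma poly_family_prod I (r : seq I) (F : I -> X -> {mpoly k[n]}) :
  (forall i, poly_family e (F i)) -> poly_family e (fun x => \prod_(i <- r) F i x).
Proof.
move=> hP; elim: r => [|i r IH].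
  by apply: poly_family_eq (poly_family_cst 1) => x _; rewrite big_nil.
by apply: poly_family_eq (poly_familyM (hP i) IH) => x _; rewrite big_cons.
Qed.

Lemma poly_fun_coeff F m : poly_family e F -> poly_fun e (fun x => (F x)@_m).
Proof. exact: poly_fun_functional. Qed.

Lemma poly_family_msize F : poly_family e F ->
  exists d, forall x, S x -> (msize (F x) <= d)%N.
Proof.
move=> [s Fs]; exists (\max_(p <- s) msize p.2) => x /Fs ->.
apply: leq_trans (msize_sum _ _ _) _; apply/bigmax_leqP_seq => p ps _.
apply: leq_trans (msizeZ_le _ _) _.
exact: (leq_bigmax_seq (F := fun p => msize p.2)).
Qed.

End Mpoly.

Lemma poly_family_comp n m (F : 'I_n -> X -> {mpoly k[m]}) (f : {mpoly k[n]}) :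
    (forall i, poly_family e (F i)) ->
  poly_family e (fun x => f \mPo [tuple F i x | i < n]).
Proof.
move=> FP; pose G x := \sum_(m <- msupp f) f@_m *: \prod_(i < n) F i x ^+ m i.
apply: (@poly_family_eq _ _ G) => [x _|].
  rewrite comp_mpolyE; apply: eq_bigr => u _; congr (_ *: _).
  by apply: eq_bigr => i _; rewrite tnth_mktuple.
apply: poly_family_sum => u; apply: poly_familyZ; first exact: poly_fun_cst.
by apply: poly_family_prod => i; apply: poly_familyX.
Qed.

Lemma poly_fun_peval_family n (a : affine k n) (F : X -> {mpoly k[n]}) :
  poly_family e F -> poly_fun e (fun x => peval (F x) a).
Proof.
move=> [s Fs]; exists (\sum_(p <- s) peval p.2 a *: p.1) => x Sx.
rewrite Fs// /peval !raddf_sum; apply: eq_bigr => p _.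
by rewrite /= !mevalZ mulrC.
Qed.

End Fixed.

Lemma poly_fun_trans M N (e : X -> affine k M) (e' : X -> affine k N) h :
  (forall j, poly_fun e' (fun x => e x ord0 j)) -> poly_fun e h -> poly_fun e' h.
Proof.
move=> /choice[Q eQ] [P hP]; exists (P \mPo [tuple Q j | j < M]) => x Sx.
rewrite hP// /peval comp_mpoly_meval; apply: meval_eq => j.
by rewrite tnth_mktuple eQ.
Qed.

Lemma poly_family_trans M N (e : X -> affine k M) (e' : X -> affine k N)
    (V : lmodType k) (F : X -> V) :
    (forall j, poly_fun e' (fun x => e x ord0 j)) ->
  poly_family e F -> poly_family e' F.
Proof.
move=> ee' [s Fs]; apply: poly_family_eq Fs _; apply: poly_family_sum => p.
apply: poly_familyZ (poly_family_cst _ _); apply: poly_fun_trans ee' _.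
exact: poly_fun_peval.
Qed.

End PolynomialFamilies.

Lemma poly_family_subset k X (S S' : set X) N (e : X -> affine k N)
    (V : lmodType k) (F : X -> V) :
  S' `<=` S -> poly_family S e F -> poly_family S' e F.
Proof. by move=> SS' [s Fs]; exists s => x /SS'/Fs. Qed.

Lemma poly_family_preimage k X Y (f : Y -> X) (S : set X) N (e : X -> affine k N)
    (V : lmodType k) (F : X -> V) :
  poly_family S e F -> poly_family (f @^-1` S) (e \o f) (F \o f).
Proof. by move=> [s Fs]; exists s => y /Fs. Qed.

Lemma closed_poly_preimage k M N (f : affine k M -> affine k N) (C : set (affine k N)) :
    (forall j, poly_fun setT id (fun v => f v ord0 j)) ->
  closed C -> closed (f @^-1` C).
Proof.
move=> /choice[Q fQ] /zariski_closedE ->.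
suff -> : f @^-1` zero_locus (vanishing C) =
    zero_locus [set P \mPo [tuple Q j | j < N] | P in vanishing C].
  exact: closed_zero_locus.
have E v P : peval (P \mPo [tuple Q j | j < N]) v = peval P (f v).
  rewrite /peval comp_mpoly_meval; apply: meval_eq => j.
  by rewrite tnth_mktuple fQ.
apply/seteqP; split=> v /= H.
  by move=> _ [P CP <-]; rewrite E; apply: H.
by move=> P CP; rewrite -E; apply: H; exists P.
Qed.

Lemma poly_regular_on k M (W : set (affine k M)) g : poly_fun W id g -> regular_on W g.
Proof.
move=> [P gP] w Ww; exists P, 1; rewrite /peval meval1 oner_neq0; split=> // w' Ww' _.
by rewrite meval1 divr1 gP.
Qed.

(** * The ind-topology *)

Section PolynomialAutomorphisms.
Variables (k : closedFieldType) (n : nat).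
Local Notation R := {mpoly k[n]}.
Local Notation aut := (polyAut k n).
Implicit Types (phi psi : aut) (f : R) (A C : set aut).

Lemma lrmorphism_comp_mpoly (h : {lrmorphism R -> R}) f :
  h f = f \mPo [tuple h 'X_i | i < n].
Proof.
rewrite {1}[f]mpolyE linear_sum /= comp_mpolyE; apply: eq_bigr => m _.
rewrite linearZ /=; congr (_ *: _); rewrite mpolyXE_id rmorph_prod.
by apply: eq_bigr => i _; rewrite rmorphXn tnth_mktuple.
Qed.

Lemma aut_act_peval phi f x : peval (phi f) x = peval f (aut_act phi x).
Proof.
rewrite lrmorphism_comp_mpoly /peval comp_mpoly_meval; apply: meval_eq => i.
by rewrite tnth_mktuple mxE.
Qed.

Lemma aut_mulE phi psi f : (phi * psi)%g f = phi (psi f).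
Proof. by []. Qed.

Lemma polyAut_X_inj phi psi : (forall i, phi 'X_i = psi 'X_i) -> phi = psi.
Proof.
move=> E; apply: polyAut_ext => f; rewrite [phi f]lrmorphism_comp_mpoly [psi f]lrmorphism_comp_mpoly.
by rewrite (eq_mktuple (fun i => psi 'X_i) E).
Qed.

Lemma coordE p phi i (m : 'X_{1..n < p.+1}) :
  coord p phi ord0 (enum_rank ((i, m) : coord_index n p)) = (phi 'X_i)@_m.
Proof. by rewrite mxE enum_rankK. Qed.

Lemma poly_family_aut p f : poly_family (aut_deg_le p) (coord p) (fun phi => phi f).
Proof.
pose F i phi := \sum_(m : 'X_{1..n < p.+1})
  coord p phi ord0 (enum_rank ((i, m) : coord_index n p)) *: 'X_[k, val m].
apply: (@poly_family_eq _ _ _ _ _ _ _ (fun phi => f \mPo [tuple F i phi | i < n])).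
  move=> phi phip; rewrite lrmorphism_comp_mpoly.
  rewrite (eq_mktuple (F^~ phi))// => i; rewrite {1}(mpolywE (phip i)); apply: eq_bigr => m _.
  by rewrite coordE.
apply: poly_family_comp => i; apply: poly_family_sum => m.
exact: poly_familyZ (poly_fun_coord _ _ _) (poly_family_cst _ _ _).
Qed.

Lemma coord_inj p phi psi :
  aut_deg_le p phi -> aut_deg_le p psi -> coord p phi = coord p psi -> phi = psi.
Proof.
move=> phip psip E.
apply: polyAut_X_inj => i; have [s hs] := poly_family_aut p 'X_i.
by rewrite (hs phi)// (hs psi)// E.
Qed.

Lemma aut_deg_leS p q : (p <= q)%N -> (aut_deg_le p : set aut) `<=` aut_deg_le q.
Proof. by move=> pq phi phip i; apply: leq_trans (phip i) _. Qed.

Lemma aut_deg_le_ex phi : exists p, aut_deg_le p phi.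
Proof.
exists (\max_(i < n) msize (phi 'X_i)) => i; apply: leqW.
exact: (leq_bigmax_cond (F := fun i => msize (phi 'X_i))).
Qed.

Lemma ind_closedP C : closed C <->
  forall p, exists2 K, closed K & forall phi, aut_deg_le p phi -> C phi <-> K (coord p phi).
Proof.
rewrite -openC; split=> [oC p|H].
  have iC : ind_open (~` C) := oC.
  have [U oU CU] := iC p; exists (~` U); first exact: open_closedC.
  move=> phi phip; have := congr1 (@^~ phi) CU => /propeqP[CU1 CU2].
  split=> [Cphi Uphi|nU].
    by have [] := CU2 (conj phip Uphi).
  by apply: contrapT => nC; apply: nU; have [] := CU1 (conj phip nC).
suff : ind_open (~` C) by [].
move=> p; have [K cK CK] := H p; exists (~` K); first exact: closed_openC.
by apply/seteqP; split=> phi [phip nC]; split=> // /(CK _ phip).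
Qed.

Lemma closed_aut_zeros (I : Type) (h : I -> aut -> k) :
  (forall i p, poly_fun (aut_deg_le p) (coord p) (h i)) ->
  closed [set phi | forall i, h i phi = 0].
Proof.
move=> hP; apply/ind_closedP => p; have /choice[P PP] := hP ^~ p.
exists (zero_locus (range P)); first exact: closed_zero_locus.
move=> phi phip; split=> [H _ [i _ <-]|H i].
  by rewrite -PP.
by rewrite PP//; apply: H; exists i.
Qed.

Lemma closed_aut_family_zeros (I : Type) (F : I -> aut -> R) :
  (forall i p, poly_family (aut_deg_le p) (coord p) (F i)) ->
  closed [set phi | forall i, F i phi = 0].
Proof.
move=> FP; suff -> : [set phi | forall i, F i phi = 0] =
    [set phi | forall im : I * 'X_{1..n}, (F im.1 phi)@_im.2 = 0].
  by apply: closed_aut_zeros => im p; apply: poly_fun_coeff.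
apply/seteqP; split=> phi /= H; first by move=> im; rewrite H mcoeff0.
by move=> i; apply/mpolyP => m; rewrite mcoeff0 (H (i, m)).
Qed.

Lemma closed_aut_deg_le p : closed (aut_deg_le p : set aut).
Proof.
suff -> : aut_deg_le p = [set phi : aut |
    forall im : 'I_n * {m : 'X_{1..n} | (p < mdeg m)%N}, (phi 'X_im.1)@_(val im.2) = 0].
  by apply: closed_aut_zeros => im q; apply/poly_fun_coeff/poly_family_aut.
apply/seteqP; split=> phi H.
  move=> [i [m pm]] /=; apply: memN_msupp_eq0; rewrite msize_mdeg_ge//.
  exact: leq_trans (H i) pm.
move=> i; rewrite msizeE; apply/bigmax_leqP_seq => m mi _; rewrite ltnS leqNgt.
by apply/negP => pm; move: mi; rewrite mcoeff_msupp (H (i, exist _ m pm)) eqxx.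
Qed.

(** Polynomial dependence on each degree stratum bounds the degree of the image, so [t] maps a
    stratum into a stratum by a polynomial map of coefficients, hence continuously. *)
Lemma closed_aut_preimage (t : aut -> aut) C :
    (forall p i, poly_family (aut_deg_le p) (coord p) (fun phi => t phi 'X_i)) ->
  closed C -> closed (t @^-1` C).
Proof.
move=> tP /ind_closedP cC; apply/ind_closedP => p.
have [q tq] : exists q, forall phi, aut_deg_le p phi -> aut_deg_le q (t phi).
  have /choice[d dP] i := poly_family_msize (tP p i).
  exists (\max_(i < n) d i) => phi phip i; apply: leqW; apply: leq_trans (dP i _ phip) _.
  exact: (leq_bigmax_cond (F := d)).
have [K cK KP] := cC q.
have /choice[P PP] j : poly_fun (aut_deg_le p) (coord p) (fun phi => coord q (t phi) ord0 j).
  pose m := (enum_val j : coord_index n q).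
  apply: poly_fun_eq (poly_fun_coeff (val m.2) (tP p m.1)) => phi _.
  by rewrite mxE.
exists ((fun v => \row_j peval (P j) v) @^-1` K).
  apply: closed_poly_preimage => // j; exists (P j) => v _; by rewrite mxE.
move=> phi phip; rewrite /preimage /=.
suff -> : \row_j peval (P j) (coord p phi) = coord q (t phi) by apply: KP; apply: tq.
by apply/rowP => j; rewrite mxE -PP.
Qed.

Lemma closed_lmul_preimage phi C : closed C -> closed [set psi | C (phi * psi)%g].
Proof.
apply: (@closed_aut_preimage (fun psi => (phi * psi)%g)) => p i.
exact/(poly_family_linear phi)/poly_family_aut.
Qed.

Lemma closed_rmul_preimage phi C : closed C -> closed [set psi | C (psi * phi)%g].
Proof.
apply: (@closed_aut_preimage (fun psi => (psi * phi)%g)) => p i.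
exact: poly_family_aut.
Qed.

Lemma closed_aut_act_preimage a (K : set (affine k n)) :
  closed K -> closed [set phi : aut | K (aut_act phi a)].
Proof.
move=> /zariski_closedE ->.
suff -> : [set phi : aut | zero_locus (vanishing K) (aut_act phi a)] =
    [set phi : aut | forall f : {f | vanishing K f}, peval (phi (sval f)) a = 0].
  by apply: closed_aut_zeros => f p; apply/poly_fun_peval_family/poly_family_aut.
apply/seteqP; split=> phi /= H.
  by move=> [f Kf]; rewrite aut_act_peval; apply: H.
by move=> f Kf; rewrite -aut_act_peval (H (exist _ f Kf)).
Qed.

Lemma lcosetP phi A psi : lcoset phi A psi <-> A (phi^-1 * psi)%g.
Proof.
split=> [[chi Achi <-]|Apsi]; first by rewrite mulKg.
by exists (phi^-1 * psi)%g => //; rewrite mulVKg.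
Qed.

Lemma closed_lcoset phi A : closed A -> closed (lcoset phi A).
Proof.
move=> cA; suff -> : lcoset phi A = [set psi | A (phi^-1 * psi)%g].
  exact: closed_lmul_preimage.
by apply/seteqP; split=> psi /lcosetP.
Qed.

Lemma poly_fun_pair_fst X (S : set X) M N (u : X -> affine k M) (v : X -> affine k N) j :
  poly_fun S (fun x => pair_pt (u x) (v x)) (fun x => u x ord0 j).
Proof.
apply: poly_fun_eq (poly_fun_coord _ _ (lshift N j)) => x _.
by rewrite /pair_pt row_mxEl.
Qed.

Lemma poly_fun_pair_snd X (S : set X) M N (u : X -> affine k M) (v : X -> affine k N) j :
  poly_fun S (fun x => pair_pt (u x) (v x)) (fun x => v x ord0 j).
Proof.
apply: poly_fun_eq (poly_fun_coord _ _ (rshift M j)) => x _.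
by rewrite /pair_pt row_mxEr.
Qed.

Lemma poly_family_aut_mul p q i :
  poly_family [set x : aut * aut | aut_deg_le p x.1 /\ aut_deg_le q x.2]
    (fun x => pair_pt (coord p x.1) (coord q x.2)) (fun x => (x.1 * x.2)%g 'X_i).
Proof.
pose F (x : aut * aut) := \sum_(m : 'X_{1..n < q.+1})
  coord q x.2 ord0 (enum_rank ((i, m) : coord_index n q)) *: x.1 'X_[k, val m].
apply: (@poly_family_eq _ _ _ _ _ _ _ F) => [x [_ xq]|].
  rewrite aut_mulE {1}(mpolywE (xq i)) linear_sum; apply: eq_bigr => m _.
  by rewrite coordE linearZ.
apply: poly_family_sum => m; apply: poly_familyZ; first exact: poly_fun_pair_snd.
apply: (poly_family_trans (e := fun x => coord p x.1)).
  by move=> j; apply: poly_fun_pair_fst.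
apply: poly_family_subset (poly_family_preimage fst (poly_family_aut p _)).
by move=> x [].
Qed.

Lemma aut_deg_le_mul p q : exists r, forall phi psi : aut,
  aut_deg_le p phi -> aut_deg_le q psi -> aut_deg_le r (phi * psi)%g.
Proof.
have /choice[d dP] i := poly_family_msize (poly_family_aut_mul p q i).
exists (\max_(i < n) d i) => phi psi phip psiq i; apply: leqW.
apply: leq_trans (dP i (phi, psi) _) _ => //.
exact: (leq_bigmax_cond (F := d)).
Qed.

End PolynomialAutomorphisms.

(** * Simple derivations and the orbit map *)

Section Reconstruction.
Variables (k : closedFieldType) (n : nat).
Local Notation R := {mpoly k[n]}.

(** Let [A J] be the matrix of the first [J] functionals on the monomials of degree below [d]. Once
    its rank is maximal, its left kernel no longer shrinks as [J] grows, so every functional kills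
    it and it is zero by separation. A right inverse of [A J] provides the [r j]. *)
Lemma finite_reconstruction (lam : nat -> R -> k) d :
    (forall j c f g, lam j (c *: f + g) = c * lam j f + lam j g) ->
    (forall f, (forall j, lam j f = 0) -> f = 0) ->
  exists J (r : nat -> R), forall f, (msize f <= d)%N ->
    f = \sum_(j < J) lam j f *: r j.
Proof.
move=> lamL lam_inj; pose N := #|{: 'X_{1..n < d}}|.
pose X (i : 'I_N) : R := 'X_[val (enum_val i)].
have lam0 j : lam j 0 = 0.
  by apply: (@addrI _ (lam j 0)); rewrite -{1}[lam j 0]mul1r -lamL scale1r !addr0.
have lam_sum j (v : 'I_N -> k) : lam j (\sum_i v i *: X i) = \sum_i v i * lam j (X i).
  elim: (index_enum _) => [|i s IH]; first by rewrite !big_nil lam0.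
  by rewrite !big_cons lamL IH.
pose A J := \matrix_(i < N, j < J) lam j (X i).
have vA J (v : 'rV_N) j : (v *m A J) ord0 j = lam j (\sum_i v ord0 i *: X i).
  by rewrite mxE lam_sum; apply: eq_bigr => i _; rewrite mxE.
have [J Jmax] : exists J, forall J', (\rank (A J') <= \rank (A J))%N.
  pose P r := `[< exists J, \rank (A J) = r >].
  have exP : exists r, P r by exists (\rank (A 0%N)); apply/asboolP; exists 0%N.
  have ubP r : P r -> (r <= N)%N by move=> /asboolP[J <-]; apply: rank_leq_row.
  have [r /asboolP[J <-] rmax] := ex_maxnP exP ubP; exists J => J'.
  by apply: rmax; apply/asboolP; exists J'.
have : row_free (A J).
  apply/inj_row_free => v vAJ.
  have v0 : \sum_i v ord0 i *: X i = 0.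
    apply: lam_inj => j; pose J' := (maxn J j.+1).
    have sub : (kermx (A J') <= kermx (A J))%MS.
      apply/rV_subP => w /sub_kermxP wA; apply/sub_kermxP/rowP => l.
      have lJ : (l < J')%N by rewrite leq_max ltn_ord.
      move/rowP: wA => /(_ (Ordinal lJ)); rewrite (vA J') => wl.
      by rewrite (vA J) wl !mxE.
    have kerJ : (kermx (A J) <= kermx (A J'))%MS.
      by have [_ <-] := mxrank_leqif_sup sub; rewrite eqn_leq mxrankS//= !mxrank_ker leq_sub2l.
    have /sub_kermxP vJ := vAJ; have /sub_kermxP/rowP := submx_trans vJ kerJ.
    have jJ : (j < J')%N by rewrite leq_max leqnn orbT.
    by move=> /(_ (Ordinal jJ)); rewrite (vA J') mxE.
  apply/rowP => i; move/mpolyP: v0 => /(_ (val (enum_val i))).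
  rewrite mcoeff0 raddf_sum /= (bigD1 i)//= mcoeffZ mcoeffX eqxx mulr1 big1 ?addr0.
    by move=> ->; rewrite mxE.
  move=> l li; rewrite mcoeffZ mcoeffX; case: eqP; rewrite ?mulr0// => E.
  by case/eqP: li; apply/enum_val_inj/val_inj.
move=> /row_freeP[B AB]; exists J, (fun j => if insub j is Some j' then \sum_i B j' i *: X i else 0).
move=> f fd; pose v := \row_i f@_(val (enum_val i : 'X_{1..n < d})) : 'rV_N.
have fv : f = \sum_i v ord0 i *: X i.
  rewrite {1}(mpolywE fd) (reindex (@enum_val _ predT)) /=; last first.
    by exists enum_rank => m _; rewrite ?enum_valK ?enum_rankK.
  by apply: eq_bigr => i _; rewrite mxE.
have vE : v = (v *m A J) *m B by rewrite -mulmxA AB mulmx1.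
rewrite {1}fv {1}vE. under eq_bigr do rewrite mxE scaler_suml.
rewrite exchange_big. apply: eq_bigr => j _ /=.
rewrite valK scaler_sumr; apply: eq_bigr => i _.
by rewrite scalerA vA -fv.
Qed.

End Reconstruction.

Section SimpleDerivation.
Variables (k : closedFieldType) (n : nat) (D : {linear {mpoly k[n]} -> {mpoly k[n]}}).
Hypotheses (derD : is_derivation D) (simpleD : is_simple D).
Local Notation R := {mpoly k[n]}.
Local Notation aut := (polyAut k n).
Implicit Types (phi psi : aut) (f g : R).

Lemma stable_ideal0 (I : set R) : is_ideal I -> (forall f, I f -> I (D f)) -> ~ I 1 ->
  forall f, I f -> f = 0.
Proof.
move=> iI ID nI f If.
have DI : D @` I `<=` I by move=> _ [g Ig <-]; apply: ID.
have [I0|IT] := simpleD iI DI.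
  by move: If; rewrite I0.
by case: nI; rewrite IT.
Qed.

(** The kernel of [h] is a [D]-stable ideal without [1]. *)
Lemma endo_commute_inj (h : {rmorphism R -> R}) : (forall f, h (D f) = D (h f)) -> injective h.
Proof.
move=> hD f g hfg; apply/eqP; rewrite -subr_eq0; apply/eqP.
apply: (@stable_ideal0 [set f | h f = 0]) => [|u hu||] /=.
- split=> [|u v hu hv|u v hv] /=; first exact: rmorph0.
    by rewrite rmorphD hu hv addr0.
  by rewrite rmorphM hv mulr0.
- by rewrite hD hu linear0.
- by rewrite rmorph1 => /eqP; rewrite oner_eq0.
- by rewrite rmorphB hfg subrr.
Qed.

Lemma Aut_free phi x : Aut D phi -> aut_act phi x = x -> phi = 1%g.
Proof.
move=> Dphi phix; pose I := [set f : R | exists s : seq (R * R),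
  f = \sum_(p <- s) p.1 * (phi p.2 - p.2)].
have ID f g : I f -> I g -> I (f + g).
  by move=> [s ->] [t ->]; exists (s ++ t); rewrite big_cat.
have I1 f g : I (f * (phi g - g)) by exists [:: (f, g)]; rewrite big_seq1.
have I0 : I 0 by exists [::]; rewrite big_nil.
apply: polyAut_ext => f; apply/eqP; rewrite -subr_eq0; apply/eqP.
apply: (@stable_ideal0 I).
- split=> // u v [s ->]; exists [seq (u * p.1, p.2) | p <- s].
  by rewrite big_map mulr_sumr; apply: eq_bigr => p _; rewrite mulrA.
- move=> _ [s ->]; elim: s => [|p s IH]; first by rewrite big_nil linear0.
  rewrite big_cons linearD; apply: (ID) => //; rewrite derD; apply: ID => //.
  by rewrite linearB /= -Dphi.
(* Evaluation at the fixed point [x] kills every generator [phi g - g], but not [1]. *)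
- move=> [s]; move/(congr1 (fun f => peval f x)); rewrite /peval meval1 raddf_sum /=.
  rewrite big1 => [/eqP|p _]; first by rewrite oner_eq0.
  have := aut_act_peval phi p.2 x; rewrite phix /peval => E.
  by rewrite mevalM mevalB E subrr mulr0.
- by rewrite -[phi f - _]mul1r.
Qed.

Lemma Aut1 : Aut D 1%g. Proof. by []. Qed.

Lemma AutM phi psi : Aut D phi -> Aut D psi -> Aut D (phi * psi)%g.
Proof. by move=> Dphi Dpsi f; rewrite !aut_mulE Dpsi Dphi. Qed.

Lemma AutV phi : Aut D phi -> Aut D (phi^-1)%g.
Proof.
move=> Dphi f; apply: (can_inj (aut_funK phi)).
have E g : phi ((phi^-1)%g g) = g by rewrite -aut_mulE mulgV.
by rewrite E Dphi E.
Qed.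

Lemma closed_Aut : closed (Aut D).
Proof.
suff -> : Aut D = [set phi | forall f, phi (D f) - D (phi f) = 0].
  apply: closed_aut_family_zeros => f p.
  apply: (@poly_family_eq _ _ _ _ _ _ _ (fun phi => phi (D f) + (-1) *: D (phi f))).
    by move=> phi _; rewrite scaleN1r.
  apply: poly_familyD; first exact: poly_family_aut.
  apply: poly_familyZ; first exact: poly_fun_cst.
  exact/poly_family_linear/poly_family_aut.
by apply/seteqP; split=> phi H f; have := H f; rewrite ?subrr => /eqP; rewrite ?subr_eq0;
  [move=> /eqP ->; rewrite subrr | move=> /eqP].
Qed.

Lemma Aut_iter phi j f : Aut D phi -> phi (iter j D f) = iter j D (phi f).
Proof. by move=> Dphi; elim: j => //= j <-; rewrite Dphi. Qed.

(** The polynomials all of whose iterated derivatives vanish at [a] form a [D]-stable ideal that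
    does not contain [1]. *)
Lemma iter_der_peval_inj (a : affine k n) f :
  (forall j, peval (iter j D f) a = 0) -> f = 0.
Proof.
pose I := [set f | forall j, peval (iter j D f) a = 0].
have iterD j g h : iter j D (g + h) = iter j D g + iter j D h.
  by elim: j => //= j ->; rewrite linearD.
have ID g h : I g -> I h -> I (g + h).
  by move=> Ig Ih j; rewrite iterD pevalD Ig Ih addr0.
have Ider g : I g -> I (D g) by move=> Ig j; rewrite -iterSr; apply: Ig.
apply: (@stable_ideal0 I) => //.
- split=> // [j|g h Ih j].
    suff -> : iter j D 0 = 0 by rewrite /peval meval0.
    by elim: j => //= j ->; rewrite linear0.
  elim: j g h Ih => [|j IH] g h Ih /=; first by rewrite pevalM (Ih 0%N) mulr0.
  (* One derivative is spent on the product by Leibniz; both terms again have a factor in [I],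
     namely [h] or [D h], so induction on [j] applies. *)
  rewrite -iterS iterSr derD iterD pevalD !IH ?addr0//.
  exact: Ider.
- by move=> /(_ 0%N) /=; rewrite /peval meval1 => /eqP; rewrite oner_eq0.
Qed.

Lemma iter_der_reconstruction (a : affine k n) d :
  exists J (r : nat -> R), forall f, (msize f <= d)%N ->
    f = \sum_(j < J) peval (iter j D f) a *: r j.
Proof.
apply: (@finite_reconstruction _ _ (fun j f => peval (iter j D f) a)).
  move=> j c f g; rewrite -[_ * _ + _]/(c * (iter j D f).@[_] + _).
  rewrite -mevalZ -mevalD; congr (peval _ _).
  by elim: j => //= j ->; rewrite linearD linearZ.
exact: iter_der_peval_inj.
Qed.

Lemma poly_family_orbit (a : affine k n) p f :
  poly_family (Aut D `&` aut_deg_le p) (fun phi => aut_act phi a) (fun phi => phi f).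
Proof.
have [J [r rP]] := iter_der_reconstruction a p.+1.
pose F i phi := \sum_(j < J) peval (iter j D 'X_i) (aut_act phi a) *: r j.
apply: (@poly_family_eq _ _ _ _ _ _ _ (fun phi => f \mPo [tuple F i phi | i < n])).
  move=> phi [Dphi phip]; rewrite lrmorphism_comp_mpoly.
  rewrite (eq_mktuple (F^~ phi))// => i; rewrite {1}(rP _ (phip i)).
  by apply: eq_bigr => j _; rewrite -Aut_iter// aut_act_peval.
apply: poly_family_comp => i; apply: poly_family_sum => j.
exact: poly_familyZ (poly_fun_peval _ _ _) (poly_family_cst _ _ _).
Qed.

Lemma poly_fun_orbit (a : affine k n) p q j :
  poly_fun (Aut D `&` aut_deg_le p) (fun phi => aut_act phi a)
    (fun phi => coord q phi ord0 j).
Proof.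
apply: poly_fun_eq (poly_fun_coeff _ (poly_family_orbit a p _)) => phi _.
by rewrite mxE.
Qed.

(** The ideal of the Zariski closure of the points phi(a), for phi in [Z]; it transports closed sets
    of automorphisms to ideals of the polynomial ring. *)
Definition orbit_ideal (a : affine k n) (Z : set aut) : set R :=
  vanishing [set aut_act phi a | phi in Z].

(** In bounded degree the coefficients of an element of [Aut D] are polynomials in its orbit point,
    so the equations of [Z] become polynomials in [orbit_ideal a Z]. *)
Lemma orbit_idealP (a : affine k n) p (Z : set aut) phi : closed Z ->
    Z `<=` Aut D `&` aut_deg_le p -> (Aut D `&` aut_deg_le p) phi ->
  (forall f, orbit_ideal a Z f -> peval f (aut_act phi a) = 0) -> Z phi.
Proof.
move=> /ind_closedP cZ Zp Ap H; have [K cK ZK] := cZ p.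
apply/ZK; first by case: Ap.
have /choice[P PP] := @poly_fun_orbit a p p.
rewrite (zariski_closedE cK) => Q KQ.
have E psi : (Aut D `&` aut_deg_le p) psi ->
    peval Q (coord p psi) = peval (Q \mPo [tuple P j | j < ncoord n p]) (aut_act psi a).
  move=> Apsi; rewrite /peval comp_mpoly_meval; apply: meval_eq => j.
  by rewrite tnth_mktuple (PP j psi).
rewrite E//; apply: H => _ [psi Zpsi <-]; rewrite -E; last exact: Zp.
by apply: KQ; apply/ZK => //; have [] := Zp _ Zpsi.
Qed.

End SimpleDerivation.

(** * The identity component *)

Section Irreducible.
Variable T : topologicalType.
Implicit Types (x : T) (Z C : set T).

Lemma irreducible1 x : irreducible [set x].
Proof.
split; first by exists x.
move=> C1 C2 _ _ H; have [C1x|C2x] := H x erefl; [left|right] => _ ->//.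
Qed.

Lemma irreducible_closure Z : irreducible Z -> irreducible (closure Z).
Proof.
move=> [[x Zx] irrZ]; split; first by exists x; apply: subset_closure.
move=> C1 C2 cC1 cC2 /(subset_trans (@subset_closure _ Z)) /(irrZ _ _ cC1 cC2).
by case=> H; [left|right]; rewrite closureE; apply: smallest_sub.
Qed.

(** If a nonempty part of [Z] is cut out both by an open [O] and by a closed [C], then [C] and the
    complement of [O] are closed and cover [Z]. *)
Lemma irreducible_connected Z : irreducible Z -> connected Z.
Proof.
move=> [_ irrZ] B [x Bx] [O oO BO] [C cC BC].
have [|ZC|ZO] := irrZ C (~` O) cC (open_closedC oO).
- by move=> y Zy; have [Oy|] := pselect (O y); [left; have : B y by rewrite BO|right];
    rewrite // BC => -[].
- by rewrite BC setIidl.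
- by move: Bx; rewrite BO => -[/ZO].
Qed.

End Irreducible.

Section Translations.
Variables (k : closedFieldType) (n : nat).
Local Notation aut := (polyAut k n).
Implicit Types (phi psi : aut) (Z : set aut).

Lemma irreducible_lcoset phi Z : irreducible Z -> irreducible (lcoset phi Z).
Proof.
move=> [[x Zx] irrZ]; split; first by exists (phi * x)%g; exists x.
move=> C1 C2 cC1 cC2 H.
have [||] := irrZ _ _ (closed_lmul_preimage (phi := phi) cC1) (closed_lmul_preimage (phi := phi) cC2).
- by move=> y Zy; apply: H; exists y.
- by move=> Z1; left => _ [y Zy <-]; apply: Z1.
- by move=> Z2; right => _ [y Zy <-]; apply: Z2.
Qed.

Definition mulset Z Z' : set aut := [set x | exists y z, [/\ Z y, Z' z & x = (y * z)%g]].

(* Only the separate continuity of the product is used: for [Z Z'] covered by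
   [C1] and [C2], each [y Z'] lies in [C1] or in [C2], and the [y] of either
   kind form a closed set. *)
Lemma irreducible_mulset Z Z' : irreducible Z -> irreducible Z' -> irreducible (mulset Z Z').
Proof.
move=> [[y Zy] irrZ] [[z Z'z] irrZ']; split; first by exists (y * z)%g, y, z.
move=> C1 C2 cC1 cC2 H.
pose W C := [set y | forall z, Z' z -> C (y * z)%g].
have cW C : closed C -> closed (W C).
  move=> cC; suff -> : W C = \bigcap_(z in Z') [set y | C (y * z)%g].
    by apply: closed_bigI => u _; apply: closed_rmul_preimage.
  by apply/seteqP; split.
have [|ZW|ZW] := irrZ _ _ (cW _ cC1) (cW _ cC2).
- move=> u Zu.
  have [||] := irrZ' _ _ (closed_lmul_preimage (phi := u) cC1) (closed_lmul_preimage (phi := u) cC2).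
  + by move=> v Z'v; apply: H; exists u, v.
  + by move=> uC; left => v /uC.
  + by move=> uC; right => v /uC.
- by left => _ [u [v [/ZW + Z'v ->]]]; apply.
- by right => _ [u [v [/ZW + Z'v ->]]]; apply.
Qed.

Lemma closed_aut1 : closed [set (1%g : aut)].
Proof.
suff -> : [set (1%g : aut)] = [set phi | forall f, phi f + (-1) *: f = 0].
  apply: closed_aut_family_zeros => f p.
  exact: poly_familyD (poly_family_aut _ _) (poly_family_cst _ _ _).
apply/seteqP; split=> [_ -> f|phi H] /=; first by rewrite scaleN1r subrr.
by apply: polyAut_ext => f; apply/eqP; rewrite -subr_eq0 -scaleN1r H.
Qed.

Lemma aut_deg_le1 : aut_deg_le 1 (1%g : aut).
Proof. by move=> i; rewrite msizeX mdeg1. Qed.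

Lemma closed_lcosets (s : seq aut) Z : closed Z ->
  closed [set phi | exists2 psi, psi \in s & lcoset psi Z phi].
Proof.
move=> cZ; elim: s => [|psi s IH].
  suff -> : [set phi | exists2 psi, psi \in [::] & lcoset psi Z phi] = set0 by exact: closed0.
  by apply/seteqP; split=> // phi [].
suff -> : [set phi | exists2 chi, chi \in psi :: s & lcoset chi Z phi] =
    lcoset psi Z `|` [set phi | exists2 chi, chi \in s & lcoset chi Z phi].
  by apply: closedU => //; apply: closed_lcoset.
apply/seteqP; split=> phi.
  by move=> [chi]; rewrite inE => /predU1P[->|chis]; [left|right; exists chi].
by move=> [|[chi chis]] H; [exists psi|exists chi] => //; rewrite inE ?eqxx// chis orbT.
Qed.

End Translations.

(** * The largest irreducible subset through the identity, and its cosets *)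

Section IdentityComponent.
Variables (k : closedFieldType) (n : nat) (D : {linear {mpoly k[n]} -> {mpoly k[n]}}).
Hypotheses (derD : is_derivation D) (simpleD : is_simple D).
Local Notation R := {mpoly k[n]}.
Local Notation aut := (polyAut k n).
Local Notation A p := (Aut D `&` aut_deg_le p).
Local Notation a := (0 : 'rV[k]_n).
Implicit Types (phi psi : aut) (Z : set aut).

Lemma closed_A p : closed (A p).
Proof. by apply: closedI; [apply: closed_Aut|apply: closed_aut_deg_le]. Qed.

Lemma orbit_idealS Z Z' : Z `<=` Z' -> orbit_ideal a Z' `<=` orbit_ideal a Z.
Proof. by move=> ZZ'; apply: vanishingS => _ [phi /ZZ' Z'phi <-]; exists phi. Qed.

Lemma orbit_ideal_proper p Z Z' : closed Z -> Z' `<=` A p -> Z `<` Z' ->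
  orbit_ideal a Z' `<` orbit_ideal a Z.
Proof.
move=> cZ Z'p [ZZ' nZ'Z]; split=> [|H]; first exact: orbit_idealS.
apply: nZ'Z => phi Z'phi; apply: (@orbit_idealP _ _ D derD simpleD a p) => //.
- exact: subset_trans ZZ' _.
- exact: Z'p.
- by move=> f /H; apply; exists phi.
Qed.

(** The orbit map is continuous, so a product vanishing on the orbit covers [Z] by the closed
    preimages of the zero loci of its two factors. *)
Lemma prime_orbit_ideal Z : irreducible Z -> prime_ideal (orbit_ideal a Z).
Proof.
move=> [[phi Zphi] irrZ]; split; first exact: is_ideal_vanishing.
  move=> /(_ (aut_act phi a)); rewrite /peval meval1 => H.
  by have /eqP := H (ex_intro2 _ _ _ Zphi erefl); rewrite oner_eq0.
move=> f g fg; pose C (h : R) := [set phi : aut | zero_locus [set h] (aut_act phi a)].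
have cC h : closed (C h).
  exact: (@closed_aut_act_preimage _ _ a _ (@closed_zero_locus _ _ [set h])).
have [|Zf|Zg] := irrZ _ _ (cC f) (cC g).
- move=> psi Zpsi; have /eqP := fg _ (ex_intro2 _ _ _ Zpsi erefl).
  by rewrite pevalM mulf_eq0 => /orP[] /eqP E; [left|right] => _ ->.
- by left => _ [psi /Zf Cpsi <-]; apply: Cpsi.
- by right => _ [psi /Zg Cpsi <-]; apply: Cpsi.
Qed.

Lemma irreducible_chain_le p m (Z : nat -> set aut) :
    (forall i, (i <= m)%N -> [/\ closed (Z i), irreducible (Z i) & Z i `<=` A p]) ->
    (forall i, (i < m)%N -> Z i `<` Z i.+1) ->
  (m <= n)%N.
Proof.
move=> ZP ltZ; apply: (@prime_chain_le k n m (fun i => orbit_ideal a (Z i))).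
  by move=> i /ZP[_ /prime_orbit_ideal].
move=> i im; have [cZ _ _] := ZP i (ltnW im); have [_ _ Zp] := ZP i.+1 im.
exact: orbit_ideal_proper Zp (ltZ i im).
Qed.

(** A counterexample would produce an infinite strictly descending sequence of closed sets, whose
    orbit ideals would ascend strictly, against [ideal_chain_stationary]. *)
Lemma closed_noetherian_ind p (Pr : set aut -> Prop) :
    (forall Z, closed Z -> Z `<=` A p ->
      (forall Z', closed Z' -> Z' `<` Z -> Pr Z') -> Pr Z) ->
  forall Z, closed Z -> Z `<=` A p -> Pr Z.
Proof.
move=> IH Z cZ Zp; apply: contrapT => nPr.
pose bad Z := [/\ closed Z, Z `<=` A p & ~ Pr Z].
have step Z1 : exists Z2, bad Z1 -> bad Z2 /\ Z2 `<` Z1.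
  have [[cZ1 Z1p nPr1]|] := pselect (bad Z1); last by exists set0.
  apply: contrapT => /forallNP H; apply: nPr1; apply: IH => // Z2 cZ2 Z21.
  apply: contrapT => nPr2; apply: (H Z2) => _; split=> //; split=> //.
  by have [Z21' _] := Z21; apply: subset_trans Z21' _.
have [next nextP] := choice step.
pose F i := iter i next Z.
have badF i : bad (F i) by elim: i => [//|i /nextP[]].
have ltF i : F i.+1 `<` F i by case: (nextP _ (badF i)).
have [||i FF] := @ideal_chain_stationary k n (fun i => orbit_ideal a (F i)).
- by move=> i; apply: is_ideal_vanishing.
- by move=> i; have [FS _] := ltF i; apply: orbit_idealS.
have [cF _ _] := badF i.+1; have [_ Fp _] := badF i.
by have [_ +] := orbit_ideal_proper cF Fp (ltF i); apply; rewrite /= FF.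
Qed.

(** Decomposition into irreducible components, as an induction principle: a nonempty reducible
    closed set is the union of two smaller closed sets. *)
Lemma closed_irreducible_ind p (Pr : set aut -> Prop) :
    Pr set0 -> (forall Z, closed Z -> irreducible Z -> Z `<=` A p -> Pr Z) ->
    (forall Z Z', Pr Z -> Pr Z' -> Pr (Z `|` Z')) ->
  forall Z, closed Z -> Z `<=` A p -> Pr Z.
Proof.
move=> Pr0 Prirr PrU; apply: (@closed_noetherian_ind p) => Z cZ Zp IH.
have [/eqP ->//|/set0P Z0] := boolP (Z == set0).
have [irrZ|] := pselect (irreducible Z); first exact: Prirr.
move=> /not_andP[//|/existsNP[C1 /existsNP[C2 /not_implyP[cC1 /not_implyP[cC2]]]]].
move=> /not_implyP[ZC /not_orP[nC1 nC2]].
rewrite -(setIidl ZC) setIUr; apply: PrU; apply: IH; try exact: closedI.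
  by split=> [x []//|ZI]; apply: nC1 => x /ZI[].
by split=> [x []//|ZI]; apply: nC2 => x /ZI[].
Qed.

(** [G] is the top of a longest chain of irreducible closed sets of bounded degree through the
    identity; lengths are at most [n]. For any competitor [Z], the closure of the product of [G] and
    [Z] is irreducible of bounded degree and contains both, so it equals [G], or else it would
    prolong the chain. *)
Lemma exists_largest_irreducible : exists G p,
  [/\ closed G, irreducible G, G `<=` A p, G 1%g &
    forall Z q, irreducible Z -> Z `<=` A q -> Z 1%g -> Z `<=` G].
Proof.
pose chain m := exists (Z : nat -> set aut) p,
  (forall i, (i <= m)%N ->
    [/\ closed (Z i), irreducible (Z i), Z i `<=` A p & Z i (1%g : aut)]) /\
  (forall i, (i < m)%N -> Z i `<` Z i.+1).
have ex_chain : exists m, `[< chain m >].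
  exists 0%N; apply/asboolP; exists (fun=> [set 1%g]), 1%N; split=> // i _; split=> //.
  - exact: closed_aut1.
  - exact: irreducible1.
  - by move=> _ ->; split; [apply: Aut1|apply: aut_deg_le1].
have chain_le m : `[< chain m >] -> (m <= n)%N.
  move=> /asboolP[Z [p [ZP ltZ]]]; apply: irreducible_chain_le ltZ.
  by move=> i /ZP[cZ iZ Zp _]; split=> //; exact: Zp.
have [m /asboolP[Z [p [ZP ltZ]]] mmax] := ex_maxnP ex_chain chain_le.
have [cG iG Gp G1] := ZP m (leqnn m).
exists (Z m), p; split=> // Z' q iZ' Z'q Z'1.
have [r rP] := aut_deg_le_mul k n p q.
pose K := closure (mulset (Z m) Z').
have GK : Z m `<=` K.
  by move=> x Gx; apply: subset_closure; exists x, 1%g; rewrite mulg1.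
have Z'K : Z' `<=` K.
  by move=> x Z'x; apply: subset_closure; exists 1%g, x; rewrite mul1g.
have Kr : K `<=` A r.
  rewrite /K closureE; apply: smallest_sub; first exact: closed_A.
  move=> _ [x [y [/Gp[Dx xp] /Z'q[Dy yq] ->]]].
  by split; [apply: AutM|apply: rP].
have [KG|nKG] := pselect (K `<=` Z m); first exact: subset_trans KG.
suff /asboolP/mmax : chain m.+1 by rewrite ltnn.
exists (fun i => if (i <= m)%N then Z i else K), (maxn p r); split=> i.
  move=> _; case: ifP => im.
    have [cZ iZ Zp Z1] := ZP i im; split=> // x /Zp[Dx xp]; split=> //.
    by apply: aut_deg_leS xp; apply: leq_maxl.
  split; first exact: closed_closure.
  - exact/irreducible_closure/irreducible_mulset.
  - by move=> x /Kr[Dx xr]; split=> //; apply: aut_deg_leS xr; apply: leq_maxr.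
  - exact: Z'K.
rewrite ltnS leq_eqVlt => /predU1P[->|im] /=; first by rewrite eqxx ltnn; split.
by rewrite im orbT; apply: ltZ.
Qed.

Section Largest.
Variables (G : set aut) (p0 : nat).
Hypotheses (cG : closed G) (iG : irreducible G) (Gp : G `<=` A p0) (G1 : G 1%g).
Hypothesis Gmax : forall Z q, irreducible Z -> Z `<=` A q -> Z 1%g -> Z `<=` G.

(** Translating [Z] by the inverse of [phi] moves it through the identity, where [Gmax] applies. *)
Lemma irreducible_sub_lcoset Z q phi : irreducible Z -> Z `<=` A q -> Z phi ->
  Z `<=` lcoset phi G.
Proof.
move=> iZ Zq Zphi x Zx; apply/lcosetP.
have [r rP] := aut_deg_le_ex (phi^-1)%g; have [l lP] := aut_deg_le_mul k n r q.
have [Dphi _] := Zq _ Zphi.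
apply: (Gmax (irreducible_lcoset (phi^-1)%g iZ) (q := l)).
- by move=> _ [y /Zq[Dy yq] <-]; split; [apply/AutM => //; apply: AutV|apply: lP].
- by exists phi => //; rewrite mulVg.
- by exists x.
Qed.

(** For [phi] in [G], the set [G] is irreducible through [phi], so it lies in the coset of [phi].
    Reading this at the identity gives inverses; reading it for the inverse of [phi] gives
    products. *)
Lemma largest_subgroup : is_subgroup G.
Proof.
have GV phi : G phi -> G (phi^-1)%g.
  move=> Gphi; have /lcosetP := irreducible_sub_lcoset iG Gp Gphi G1.
  by rewrite mulg1.
split=> // phi psi Gphi Gpsi.
have /lcosetP := irreducible_sub_lcoset iG Gp (GV _ Gphi) Gpsi.
by rewrite invgK.
Qed.

Lemma finite_lcosets_cover q : exists s : seq aut,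
  (forall psi, psi \in s -> Aut D psi) /\
  A q `<=` [set phi | exists2 psi, psi \in s & lcoset psi G phi].
Proof.
pose Pr Z := exists s : seq aut, (forall psi, psi \in s -> Aut D psi) /\
  Z `<=` [set phi | exists2 psi, psi \in s & lcoset psi G phi].
suff : Pr (A q) by [].
apply: (@closed_irreducible_ind q) (@closed_A q) _ => //.
- by exists [::]; split=> // psi; rewrite in_nil.
- move=> Z cZ iZ Zq; have [[phi Zphi] _] := iZ; have [Dphi _] := Zq _ Zphi.
  exists [:: phi]; split=> [psi|x Zx]; first by rewrite inE => /eqP ->.
  by exists phi; rewrite ?inE//; apply: irreducible_sub_lcoset iZ Zq Zphi _ Zx.
- move=> Z Z' [s [sD Zs]] [s' [sD' Zs']]; exists (s ++ s'); split=> [psi|x].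
    by rewrite mem_cat => /orP[/sD|/sD'].
  by move=> [/Zs|/Zs'] [psi psis xpsi]; exists psi; rewrite // mem_cat psis ?orbT.
Qed.

(** In each degree the complement is traced out by finitely many cosets, namely those of the
    representatives outside [G]. *)
Lemma closed_Aut_setD : closed (Aut D `\` G).
Proof.
apply/ind_closedP => q; have [s [sD qs]] := finite_lcosets_cover q.
pose s' := [seq psi <- s | `[< ~ G psi >]].
pose E := Aut D `&` [set phi | exists2 psi, psi \in s' & lcoset psi G phi].
have cE : closed E by apply: closedI; [apply: closed_Aut|apply: closed_lcosets].
have /ind_closedP/(_ q)[K cK EK] := cE; exists K => // phi phiq.
have [_ GM GV] := largest_subgroup.
suff -> : (Aut D `\` G) phi <-> E phi by apply: EK.
split=> [[Dphi nG]|[Dphi [psi psis' psiG]]]; split=> //.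
  have [psi psis psiG] := qs _ (conj Dphi phiq); exists psi => //.
  rewrite mem_filter psis andbT; apply/asboolP => Gpsi; apply: nG.
  by move/lcosetP: psiG => /(GM _ _ Gpsi); rewrite mulVKg.
move: psis' psiG; rewrite mem_filter => /andP[/asboolP nG _] /lcosetP psiG Gphi; apply: nG.
by have := GM _ _ Gphi (GV _ psiG); rewrite invgM invgK mulVKg.
Qed.

(** [G] is connected because it is irreducible, and it is both closed and open in [Aut D], so it
    contains the component it meets. *)
Lemma Aut0_eq : Aut0 D = G.
Proof.
have GD : G `<=` Aut D by move=> x /Gp[].
apply/seteqP; split; last first.
  by apply: connected_component_max => //; apply: irreducible_connected.
have conn := @component_connected _ (Aut D) (1%g : aut).
have D1 : Aut0 D 1%g by apply: connected_component_refl; apply: Aut1.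
apply/setIidPl; apply: conn; first by exists 1%g.
  exists (~` (Aut D `\` G)); first exact/closed_openC/closed_Aut_setD.
  apply/seteqP; split=> x [Dx Gx]; split=> //; first by move=> [].
  apply: contrapT => nG; apply: Gx; split=> //.
  exact: connected_component_sub Dx.
by exists G.
Qed.

End Largest.

Lemma Aut0_spec : exists p, [/\ closed (Aut0 D), Aut0 D `<=` A p, is_subgroup (Aut0 D) &
  forall q, exists s : seq aut, (forall psi, psi \in s -> Aut D psi) /\
    A q `<=` [set phi | exists2 psi, psi \in s & lcoset psi (Aut0 D) phi]].
Proof.
have [G [p [cG iG Gp G1 Gmax]]] := exists_largest_irreducible.
exists p; rewrite (Aut0_eq cG iG Gp G1 Gmax); split=> //.
  exact: (largest_subgroup iG Gp G1 Gmax).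
by move=> q; apply: (finite_lcosets_cover Gmax q).
Qed.

End IdentityComponent.

(** * Affineness and regularity *)

Section Cramer.
Variables (k : closedFieldType) (n : nat).
Local Notation R := {mpoly k[n]}.

(** The coefficient matrix of the [u i] is row free; the columns of a right inverse [B] are the
    functionals, read on coefficients. *)
Lemma dual_functionals N (u : 'I_N -> R) :
    (forall c : 'I_N -> k, \sum_i c i *: u i = 0 -> forall i, c i = 0) ->
  exists beta : 'I_N -> {scalar R}, forall i j, beta j (u i) = (i == j)%:R.
Proof.
move=> u_free; pose d := \max_i msize (u i).
have ud i : (msize (u i) <= d)%N by apply: leq_bigmax_cond.
pose L := #|{: 'X_{1..n < d}}|.
pose U := \matrix_(i < N, l < L) (u i)@_(val (enum_val l : 'X_{1..n < d})).
have : row_free U.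
  apply/inj_row_free => v vU; apply/rowP => i; rewrite mxE.
  apply: (u_free (v ord0)); apply/mpolyP => m; rewrite mcoeff0 raddf_sum /=.
  have [md|md] := ltnP (mdeg m) d; last first.
    apply: big1 => j _; rewrite mcoeffZ memN_msupp_eq0 ?mulr0// msize_mdeg_ge//.
    exact: leq_trans (ud j) md.
  move/rowP: vU => /(_ (enum_rank (BMultinom md))); rewrite !mxE => vU.
  by rewrite -[RHS]vU; apply: eq_bigr => j _; rewrite mcoeffZ !mxE enum_rankK.
move=> /row_freeP[B UB].
pose b j (f : R) := \sum_(l < L) f@_(val (enum_val l : 'X_{1..n < d})) * B l j.
have b_scalar j : scalar (b j).
  move=> c f g; rewrite /b mulr_sumr -big_split; apply: eq_bigr => l _ /=.
  by rewrite mcoeffD mcoeffZ mulrDl mulrA.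
pose beta j : {scalar R} := HB.pack (b j) (GRing.isLinear.Build _ _ _ _ (b j) (b_scalar j)).
exists beta => i j; move/matrixP: UB => /(_ i j); rewrite !mxE => <-.
by apply: eq_bigr => l _; rewrite mxE.
Qed.

Section Families.
Variables (X : Type) (S : set X) (N : nat) (e : X -> affine k N).
Variable h : X -> {linear R -> R}.
Hypothesis hP : forall f, poly_family S e (fun x => h x f).

Lemma poly_family_apply (F : X -> R) : poly_family S e F ->
  poly_family S e (fun x => h x (F x)).
Proof.
move=> [s Fs].
apply: (@poly_family_eq _ _ _ _ _ _ _ (fun x => \sum_(p <- s) peval p.1 (e x) *: h x p.2)).
  by move=> x Sx; rewrite Fs// linear_sum; apply: eq_bigr => p _; rewrite linearZ.
apply: poly_family_sum => p; apply: poly_familyZ => //; exact: poly_fun_peval.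
Qed.

(* Cramer's rule for the linear system [h x y = g] in the unknown [y], in
   coordinates in which its matrix is the identity at [x0]. *)
Lemma cramer_family (x0 : X) (d : nat) : injective (h x0) ->
  exists (delta : X -> k) (Y : R -> X -> R),
    [/\ poly_fun S e delta, forall g, poly_family S e (Y g), delta x0 = 1 &
        forall x y, (msize y <= d)%N -> delta x *: y = Y (h x y) x].
Proof.
move=> h_inj; pose L := #|{: 'X_{1..n < d}}|.
pose mon (i : 'I_L) : R := 'X_[val (enum_val i)].
have mon_free (c : 'I_L -> k) : \sum_i c i *: mon i = 0 -> forall i, c i = 0.
  move=> c0 i; move/mpolyP: c0 => /(_ (val (enum_val i))).
  rewrite mcoeff0 raddf_sum /= (bigD1 i)//= mcoeffZ mcoeffX eqxx mulr1 big1 ?addr0//.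
  move=> l li; rewrite mcoeffZ mcoeffX; case: eqP; rewrite ?mulr0// => E.
  by case/eqP: li; apply/enum_val_inj/val_inj.
have [c|beta betaP] := @dual_functionals L (fun i => h x0 (mon i)).
  move=> hc; apply: mon_free; apply: h_inj; rewrite linear0 -[RHS]hc linear_sum.
  by apply: eq_bigr => i _; rewrite linearZ.
pose M x := \matrix_(i < L, j < L) beta j (h x (mon i)).
have MP i j : poly_fun S e (fun x => M x i j).
  by apply: poly_fun_eq (poly_fun_functional (beta j) (hP (mon i))) => x _; rewrite mxE.
pose b g : 'rV_L := \row_j beta j g.
exists (fun x => \det (M x)), (fun g x => \sum_i (b g *m \adj (M x)) ord0 i *: mon i).
split.
- exact: poly_fun_det.
- move=> g; apply: poly_family_sum => i; apply: poly_familyZ; last exact: poly_family_cst.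
  apply: (@poly_fun_eq _ _ _ _ _ _ (fun x => \sum_j b g ord0 j * cofactor (M x) i j)).
    by move=> x _; rewrite mxE; apply: eq_bigr => j _; rewrite [X in _ * X]mxE.
  apply: poly_fun_sum => j; apply: poly_funM; first exact: poly_fun_cst.
  apply: poly_funM; first exact: poly_fun_cst.
  apply: poly_fun_det => i' j'.
  by apply: poly_fun_eq (MP (lift i i') (lift j j')) => x _; rewrite !mxE.
- suff -> : M x0 = 1%:M by rewrite det1.
  by apply/matrixP => i j; rewrite !mxE betaP.
- move=> x y yd; pose c : 'rV_L := \row_i y@_(val (enum_val i : 'X_{1..n < d})).
  have yc : y = \sum_i c ord0 i *: mon i.
    rewrite {1}(mpolywE yd) (reindex (@enum_val _ predT)) /=; last first.
      by exists enum_rank => m _; rewrite ?enum_valK ?enum_rankK.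
    by apply: eq_bigr => i _; rewrite mxE.
  have -> : b (h x y) = c *m M x.
    apply/rowP => j; rewrite !mxE {1}yc !linear_sum; apply: eq_bigr => i _.
    by rewrite !linearZ /= [X in _ = _ * X]mxE.
  rewrite -mulmxA mul_mx_adj mul_mx_scalar {1}yc scaler_sumr.
  by apply: eq_bigr => i _; rewrite scalerA; congr (_ *: _); rewrite [RHS]mxE.
Qed.

End Families.
End Cramer.

(** * Closedness of orbits and affineness *)

Section Affineness.
Variables (k : closedFieldType) (n : nat) (D : {linear {mpoly k[n]} -> {mpoly k[n]}}).
Hypotheses (derD : is_derivation D) (simpleD : is_simple D).
Local Notation R := {mpoly k[n]}.
Local Notation aut := (polyAut k n).
Local Notation A p := (Aut D `&` aut_deg_le p).
Local Notation a := (0 : 'rV[k]_n).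
Implicit Types (phi psi : aut) (Z : set aut).

(** The chosen preimages of the variables define a right inverse of [h]; it is also a left inverse,
    since [h] is injective by simplicity of [D]. *)
Lemma endo_commute_aut (h : {lrmorphism R -> R}) :
    (forall f, h (D f) = D (h f)) -> (forall i, exists y, h y = 'X_i) ->
  exists2 phi : aut, Aut D phi & phi =1 h.
Proof.
move=> hD /choice[y hy].
pose h' : {lrmorphism R -> R} := comp_mpoly [tuple y i | i < n].
have h'K : cancel h' h.
  move=> f; transitivity (f \mPo [tuple 'X_i | i < n]); last exact: comp_mpoly_id.
  have := lrmorphism_comp_mpoly (h \o h' : {lrmorphism R -> R}) f => /= ->.
  rewrite (eq_mktuple (fun i => 'X_i))// => i.
  by rewrite /h' /= comp_mpolyXU -tnth_nth tnth_mktuple hy.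
have hK : cancel h h' by move=> f; apply: (endo_commute_inj simpleD hD); exact: h'K.
by exists (PolyAut hK h'K).
Qed.

Section BoundedInverse.
Variables (Z : set aut) (p q : nat).
Hypotheses (cZ : closed Z) (Zp : Z `<=` A p)
  (Zq : forall phi, Z phi -> aut_deg_le q (phi^-1)%g).
Let V := zero_locus (orbit_ideal a Z).

(** Polynomial identities valid on the orbit persist on its closure [V]; this is how properties of
    the elements of [Z] reach the limit points. *)
Lemma orbit_closure_fun h b : poly_fun setT id h ->
  (forall phi, Z phi -> h (aut_act phi a) = 0) -> V b -> h b = 0.
Proof.
move=> [P hP] H Vb; rewrite hP//; apply: Vb => _ [phi Zphi <-].
by rewrite -[LHS]hP// H.
Qed.

Lemma orbit_closure_family (F : affine k n -> R) b : poly_family setT id F ->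
  (forall phi, Z phi -> F (aut_act phi a) = 0) -> V b -> F b = 0.
Proof.
move=> FP H Vb; apply/mpolyP => m; rewrite mcoeff0.
apply: (@orbit_closure_fun (fun b => (F b)@_m)) => //; first exact: poly_fun_coeff.
by move=> phi Zphi; rewrite H// mcoeff0.
Qed.

(** The reconstruction formula makes sense at any [b] in [V] and defines an endomorphism [h b]. It
    commutes with [D] by passage to the closure, so it is injective. It is surjective because the
    inverses of elements of [Z] have bounded degree; the resulting automorphism sends [a] to [b] and
    lies in [Z]. *)
Lemma orbit_closed b : V b -> exists2 phi, Z phi & aut_act phi a = b.
Proof.
move=> Vb; have [J [r rP]] := iter_der_reconstruction derD simpleD a p.+1.
pose F i b := \sum_(j < J) peval (iter j D 'X_i) b *: r j.
have FP i : poly_family setT id (F i).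
  apply: poly_family_sum => j.
  exact: poly_familyZ (poly_fun_peval _ _ _) (poly_family_cst _ _ _).
pose h (b : affine k n) : {lrmorphism R -> R} := comp_mpoly [tuple F i b | i < n].
have hX b' i : h b' 'X_i = F i b'.
  by rewrite /h /= comp_mpolyXU -tnth_nth tnth_mktuple.
have hP f : poly_family setT id (fun b => h b f) by apply: poly_family_comp.
have FZ phi i : Z phi -> F i (aut_act phi a) = phi 'X_i.
  move=> /Zp[Dphi phip]; rewrite [RHS](rP _ (phip i)); apply: eq_bigr => j _.
  by rewrite -Aut_iter// aut_act_peval.
have hZ phi f : Z phi -> h (aut_act phi a) f = phi f.
  move=> Zphi; rewrite [RHS]lrmorphism_comp_mpoly /h /=.
  by rewrite (eq_mktuple (fun i => phi 'X_i))// => i; rewrite FZ.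
have hD f : h b (D f) = D (h b f).
  apply/eqP; rewrite -subr_eq0 -scaleN1r; apply/eqP.
  apply: (@orbit_closure_family (fun b => h b (D f) + (-1) *: D (h b f))) => //.
    apply: poly_familyD => //; apply: poly_familyZ; first exact: poly_fun_cst.
    exact: poly_family_linear.
  by move=> phi Zphi; have [Dphi _] := Zp Zphi; rewrite !hZ// Dphi scaleN1r subrr.
have h_inj : injective (h b) := endo_commute_inj simpleD hD.
have [i|phi Dphi phih] := endo_commute_aut hD.
  (* On the orbit, the inverse image of ['X_i] is given by Cramer's rule with denominator [delta].
     The cleared identity [h (Y 'X_i) = delta *: 'X_i] extends to [b], where [delta] is 1. Degree at
     most [q] means [msize] at most [q.+1]. *)
  have [delta [Y [deltaP YP delta1 cramer]]] :=
    @cramer_family _ _ _ setT _ id (fun b => h b : {linear R -> R}) hP b q.+1 h_inj.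
  exists (Y 'X_i b); apply/eqP; rewrite -subr_eq0 -[X in _ - X]scale1r -delta1 -scaleN1r.
  apply/eqP.
  apply: (@orbit_closure_family (fun b => h b (Y 'X_i b) + (-1) *: (delta b *: 'X_i))) => //.
    apply: poly_familyD.
      exact: (@poly_family_apply _ _ _ _ _ _ (fun b => h b : {linear R -> R})).
    apply: poly_familyZ; first exact: poly_fun_cst.
    exact: poly_familyZ (poly_family_cst _ _ _).
  move=> phi Zphi; have E := cramer (aut_act phi a) _ (Zq Zphi i).
  have XE : h (aut_act phi a) ((phi^-1)%g 'X_i) = 'X_i.
    by rewrite hZ// -aut_mulE mulgV.
  have {}E : delta (aut_act phi a) *: (phi^-1)%g 'X_i = Y 'X_i (aut_act phi a).
    by rewrite E; congr (Y _ _); exact: XE.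
  by rewrite -E linearZ /= XE scaleN1r subrr.
have phib : aut_act phi a = b.
  apply/rowP => i; rewrite mxE phih hX; apply/eqP; rewrite -subr_eq0 -mulN1r; apply/eqP.
  apply: (@orbit_closure_fun (fun b => peval (F i b) a + (-1) * b ord0 i)).
  - apply: poly_funD; first exact: poly_fun_peval_family.
    by apply: poly_funM; [apply: poly_fun_cst|apply: poly_fun_coord].
  - by move=> psi Zpsi; rewrite FZ// mxE mulN1r subrr.
  - by [].
exists phi => //; apply: (@orbit_idealP _ _ D derD simpleD a p) => //; last first.
  by move=> f /Vb; rewrite phib.
(* The degree bound passes to the closure too: the coefficients in degree above [p] vanish on the
   orbit. *)
split=> // i; rewrite phih hX msizeE; apply/bigmax_leqP_seq => m mi _; rewrite ltnS leqNgt.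
apply/negP => pm; move: mi; rewrite mcoeff_msupp => /eqP; apply.
apply: (@orbit_closure_fun (fun b => (F i b)@_m)) => //; first exact: poly_fun_coeff.
move=> psi Zpsi; rewrite FZ//; have [_ /(_ i) psip] := Zp Zpsi.
by rewrite memN_msupp_eq0// msize_mdeg_ge// (leq_trans psip).
Qed.

(** The orbit map identifies the coefficient image of [Z] with the closed set [V]: it is polynomial
    in the coefficients, and its inverse is polynomial by [poly_fun_orbit]. *)
Lemma is_affine_coord : is_affine (coord p @` Z).
Proof.
exists n, V; split; first exact: closed_zero_locus.
have /choice[P PP] i : poly_fun (aut_deg_le p) (coord p) (fun phi => aut_act phi a ord0 i).
  apply: poly_fun_eq (poly_fun_peval_family a (poly_family_aut p 'X_i)) => phi _.
  by rewrite mxE.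
have /choice[Q QP] := @poly_fun_orbit _ _ D derD simpleD a p p.
pose f w : affine k n := \row_i peval (P i) w.
pose g b : affine k (ncoord n p) := \row_j peval (Q j) b.
have fZ phi : Z phi -> f (coord p phi) = aut_act phi a.
  by move=> /Zp[_ phip]; apply/rowP => i; rewrite mxE -PP.
have gZ phi : Z phi -> g (aut_act phi a) = coord p phi.
  by move=> /Zp Ap; apply/rowP => j; rewrite mxE -[LHS]QP.
exists f, g; split.
- split=> [_ [_ [phi Zphi <-] <-]|i].
    by rewrite fZ// => h; apply; exists phi.
  by apply: poly_regular_on; exists (P i) => w _; rewrite mxE.
- split=> [_ [b /orbit_closed[phi Zphi <-] <-]|j].
    by rewrite gZ//; exists phi.
  by apply: poly_regular_on; exists (Q j) => w _; rewrite mxE.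
- by move=> _ [phi Zphi <-]; rewrite fZ// gZ.
- by move=> b /orbit_closed[phi Zphi <-]; rewrite gZ// fZ.
Qed.

End BoundedInverse.
End Affineness.

(** * Regularity of multiplication, inversion and the action *)

Section RegularOperations.
Variables (k : closedFieldType) (n : nat).
Local Notation R := {mpoly k[n]}.
Local Notation aut := (polyAut k n).
Variables (G : set aut) (p : nat).
Hypotheses (sG : is_subgroup G) (Gp : G `<=` aut_deg_le p).

Lemma subgroup_regular_mul : regular_mul G p.
Proof.
have [_ GM _] := sG.
have /choice[P PP] j : poly_fun [set x : aut * aut | aut_deg_le p x.1 /\ aut_deg_le p x.2]
    (fun x => pair_pt (coord p x.1) (coord p x.2)) (fun x => coord p (x.1 * x.2)%g ord0 j).
  apply: poly_fun_eq (poly_fun_coeff _ (poly_family_aut_mul k p p _)) => x _.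
  by rewrite mxE.
pose m w : affine k (ncoord n p) := \row_j peval (P j) w.
have mE phi psi : G phi -> G psi ->
    m (pair_pt (coord p phi) (coord p psi)) = coord p (phi * psi)%g.
  move=> Gphi Gpsi; apply/rowP => j; rewrite mxE.
  by rewrite -(PP j (phi, psi))//; split; apply: Gp.
exists m => //; split=> [_ [_ [_ [_ [[phi Gphi <-] [psi Gpsi <-] ->]]] <-]|j].
  by rewrite mE//; exists (phi * psi)%g => //; apply: GM.
by apply: poly_regular_on; exists (P j) => w _; rewrite mxE.
Qed.

Lemma subgroup_regular_inv : regular_inv G p.
Proof.
have [_ _ GV] := sG.
(* Inversion is first obtained as a plain function by choice, with arbitrary values off the image of
   [G]; its regularity is then checked locally. *)
have /choice[i iP] (w : affine k (ncoord n p)) : exists u : affine k (ncoord n p),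
    forall phi, G phi -> coord p phi = w -> u = coord p (phi^-1)%g.
  have [[phi Gphi <-]|] := pselect ((coord p @` G) w); last first.
    by move=> nGw; exists w => phi Gphi E; case: nGw; exists phi.
  by exists (coord p (phi^-1)%g) => psi Gpsi /coord_inj ->//; apply: Gp.
exists i => [|phi Gphi]; last exact: iP.
split=> [_ [_ [phi Gphi <-] <-]|j].
  by rewrite (iP _ phi)//; exists (phi^-1)%g => //; apply: GV.
move=> _ [phi0 Gphi0 <-].
(* Near [phi0], Cramer's rule solves [phi y = 'X_i] for [y] the image of ['X_i] under the inverse of
   [phi]. The coefficients of [y] are quotients with denominator [delta], which is 1 at [phi0]. *)
have [delta [Y [[Q QP] YP delta1 cramer]]] :=
  @cramer_family k n aut _ _ _ (fun phi : aut => phi : {linear R -> R})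
    (@poly_family_aut k n p) phi0 p.+1 (can_inj (aut_funK phi0)).
pose im := (enum_val j : coord_index n p).
have [P PP] := poly_fun_coeff (val im.2) (YP 'X_im.1).
have p0 := Gp Gphi0.
exists P, Q; rewrite -QP// delta1 oner_neq0; split=> // _ [phi Gphi <-].
have phip := Gp Gphi; rewrite -QP// => deltaphi.
rewrite -PP//.
rewrite (iP _ phi)// mxE -/im.
have phiV : phi ((phi^-1)%g 'X_im.1) = 'X_im.1 by rewrite -aut_mulE mulgV.
have := cramer phi _ (Gp (GV _ Gphi) im.1); rewrite /= phiV => <-.
by rewrite mcoeffZ mulrC mulKf.
Qed.

Lemma bounded_acts_regularly : acts_regularly G.
Proof.
exists p => //.
have /choice[P PP] j : poly_fun [set x : aut * affine k n | aut_deg_le p x.1]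
    (fun x => pair_pt (coord p x.1) x.2) (fun x => aut_act x.1 x.2 ord0 j).
  pose F (x : aut * affine k n) := \sum_(m : 'X_{1..n < p.+1})
    coord p x.1 ord0 (enum_rank ((j, m) : coord_index n p)) * peval 'X_[val m] x.2.
  apply: (@poly_fun_eq _ _ _ _ _ _ F) => [x xp|].
    rewrite mxE {1}(mpolywE (xp j)) /peval raddf_sum; apply: eq_bigr => m _.
    by rewrite coordE /= mevalZ.
  apply: poly_fun_sum => m; apply: poly_funM; first exact: poly_fun_pair_fst.
  apply: (poly_fun_trans (e := snd)); last exact: poly_fun_peval.
  by move=> l; apply: poly_fun_pair_snd.
exists (fun w => \row_j peval (P j) w) => [|phi x Gphi].
  split=> // j.
  by apply: poly_regular_on; exists (P j) => w _; rewrite mxE.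
by apply/rowP => j; rewrite mxE -(PP j (phi, x))//; apply: Gp.
Qed.

End RegularOperations.

(** * Enumeration of the cosets and proof of the theorem *)

Lemma lcoset_enumeration (k : closedFieldType) (n : nat) (A G : set (polyAut k n)) :
    A 1%g ->
    (forall q, exists s : seq (polyAut k n), (forall psi, psi \in s -> A psi) /\
      A `&` aut_deg_le q `<=` [set phi | exists2 psi, psi \in s & lcoset psi G phi]) ->
  exists phi : nat -> polyAut k n, [/\ forall i, A (phi i), phi 0%N = 1%g &
    forall q, exists m, A `&` aut_deg_le q `<=` \bigcup_(i in `I_m.+1) lcoset (phi i) G].
Proof.
move=> A1 /choice[s sP].
(* Index 0 is reserved for the identity. Index [i'.+1] decodes [i'] as a pair: a degree [q] and a
   position in the list [s q]; the identity is the default value. *)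
pose phi i := if i is i'.+1 then
  if (unpickle i' : option (nat * nat)) is Some (q, j) then nth 1%g (s q) j else 1%g else 1%g.
exists phi; split=> //.
  move=> [|i] //=; case: (unpickle i) => [[q j]|//].
  have [jq|qj] := ltnP j (size (s q)); last by rewrite nth_default.
  by have [sA _] := sP q; apply/sA/mem_nth.
move=> q; pose c (j : nat) := pickle (q, j).
exists (\max_(j < size (s q)) (c j).+1) => x Ax; have [_ /(_ x Ax)[psi psis xpsi]] := sP q.
exists (c (index psi (s q))).+1; last by rewrite /= /c pickleK nth_index.
have js : (index psi (s q) < size (s q))%N by rewrite index_mem.
exact: (leq_bigmax_cond (F := fun j : 'I_(size (s q)) => (c j).+1) (Ordinal js)).
Qed.

Theorem theorem3p2 (k : closedFieldType) (char0 : [pchar k] =i pred0)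
    (n : nat) (D : {linear {mpoly k[n]} -> {mpoly k[n]}})
    (derD : is_derivation D) (simpleD : is_simple D) :
  [/\ affine_algebraic_group (Aut0 D),
      dim_le (Aut0 D) n,
      acts_regularly (Aut0 D) /\ acts_freely (Aut0 D) &
      exists phi : nat -> polyAut k n,
        [/\ forall i, Aut D (phi i),
            phi 0%N = 1%g,
            Aut D = \bigcup_i lcoset (phi i) (Aut0 D) &
            affine_filtration (Aut D)
              (fun m => \bigcup_(i in `I_m.+1) lcoset (phi i) (Aut0 D))]].
Proof.
have [p [cG Gp sG cover]] := Aut0_spec derD simpleD.
have GD : Aut0 D `<=` Aut D by move=> x /Gp[].
have Gdeg : Aut0 D `<=` aut_deg_le p by move=> x /Gp[].
have [G1 GM GV] := sG.
split.
- split=> //; exists p; split=> //.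
  (* Inverses stay in the group, so they obey the same degree bound [p]. *)
  + by apply: (is_affine_coord derD simpleD cG Gp (q := p)) => phi /GV/Gdeg.
  + exact: subgroup_regular_mul.
  + exact: subgroup_regular_inv.
(* As [Aut0 D] is closed and of bounded degree, its relatively closed subsets are closed sets to
   which the chain bound applies. *)
- move=> m Z ZP ltZ; apply: (irreducible_chain_le derD simpleD (p := p) _ ltZ).
  by move=> i /ZP[[C cC ->] irrZ]; split=> //; [exact: closedI|move=> x [/Gp]].
- split; first exact: bounded_acts_regularly Gdeg.
  by move=> phi x /GD Dphi; apply: (Aut_free derD simpleD Dphi).
have [phi [phiD phi0 phiP]] := lcoset_enumeration (@Aut1 _ _ D) cover.
have cosetD i : lcoset (phi i) (Aut0 D) `<=` Aut D.
  by move=> _ [x /GD Dx <-]; apply: AutM.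
have AutE : Aut D = \bigcup_i lcoset (phi i) (Aut0 D).
  apply/seteqP; split=> [x Dx|x [i _ /cosetD//]].
  have [q xq] := aut_deg_le_ex x; have [m /(_ x (conj Dx xq))[i _ xi]] := phiP q.
  by exists i.
exists phi; split=> //; split=> //.
- move=> m; set X := \bigcup_(i in _) _.
  have cX : closed X.
    suff -> : X = [set x | exists2 psi, psi \in [seq phi i | i <- iota 0 m.+1] &
        lcoset psi (Aut0 D) x] by apply: closed_lcosets.
    apply/seteqP; split=> x [i im xi]; last first.
      by case/mapP: im xi => j; rewrite mem_iota => jm -> xj; exists j.
    by exists (phi i) => //; apply/mapP; exists i; rewrite // mem_iota.
  (* Affineness requires degree bounds on inverses as well. An element of a coset has as inverse the
     product of an element of the group and the fixed inverse of [phi i], so each coset, and then a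
     finite union of cosets, has such a bound. *)
  have /choice[d dP] i : exists d, forall x, lcoset (phi i) (Aut0 D) x ->
      aut_deg_le d x /\ aut_deg_le d (x^-1)%g.
    have [l phil] := aut_deg_le_ex (phi i).
    have [l' phil'] := aut_deg_le_ex ((phi i)^-1)%g.
    have [r rP] := aut_deg_le_mul k n l p.
    have [r' rP'] := aut_deg_le_mul k n p l'.
    exists (maxn r r') => _ [x Gx <-]; split.
      by apply: (aut_deg_leS (leq_maxl r r')); apply: rP => //; apply: Gdeg.
    rewrite invgM; apply: (aut_deg_leS (leq_maxr r r')); apply: rP' => //.
    exact/Gdeg/GV.
  pose q := (\max_(i < m.+1) d i)%N.
  have Xq x : X x -> aut_deg_le q x /\ aut_deg_le q (x^-1)%g.
    move=> [i /= im /dP[xd xVd]]; have dq : (d i <= q)%N.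
      exact: (leq_bigmax_cond (F := fun i : 'I_m.+1 => d i) (Ordinal im)).
    by split; apply: aut_deg_leS dq _ _.
  split=> //; exists q; first by move=> x /Xq[].
  apply: (is_affine_coord derD simpleD cX (q := q)); last by move=> x /Xq[].
  by move=> x Xx; have [xq _] := Xq x Xx; split=> //; case: Xx => i _ /cosetD.
- by move=> m x [i im xi]; exists i => //; apply: leqW.
- apply/seteqP; split=> [x|x [m _ [i _ /cosetD//]]].
  by rewrite {1}AutE => -[i _ xi]; exists i => //; exists i => /=.
Qed.
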